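(* Let $d=2m$, where $m$ is an odd integer with $m\ge 3$. (i) If $K\in\{\mathbb{Q}_2(\sqrt{2}),\mathbb{Q}_2(\sqrt{10}),\mathbb{Q}_2(\sqrt{-2}),\mathbb{Q}_2(\sqrt{-10})\}$, then $\Gamma^*(d,K)=\frac{3}{2}d$. (ii) If $K\in\{\mathbb{Q}_2(\sqrt{-1}),\mathbb{Q}_2(\sqrt{-5})\}$, then $\Gamma^*(d,K)=d+1$.
   Context: An additive form of degree $d$ over a field $K$ is a polynomial $a_1x_1^d+\dots+a_sx_s^d$ with $a_i\in K$. A nontrivial zero is a point $(x_1,\dots,x_s)\in K^s$, not all $x_i$ zero, at which the form vanishes. $\Gamma^*(d,K)$ denotes the minimal number $s$ of variables such that every additive form of degree $d$ in $s$ variables with coefficients in $K$ has a nontrivial zero in $K$. *)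

(* Defs.v *)
From mathcomp Require Import all_boot all_order all_algebra.
Set Implicit Arguments. Unset Strict Implicit. Unset Printing Implicit Defensive.
Import GRing.Theory Num.Theory.
Local Open Scope ring_scope.

(* A 2-adic integer x = sum_{i>=0} x_i 2^i, given by its binary digits.
   This is a bijective description of Z_2. *)
Definition Z2 := nat -> bool.

(* The truncation of x modulo 2^n, i.e. the image of x under the ring
   homomorphism Z_2 -> Z/2^n Z, represented by an integer in [0, 2^n). *)
Definition Z2trunc (n : nat) (x : Z2) : int :=
  \sum_(i < n) (nat_of_bool (x i))%:Z * 2 ^+ i.

(* An element of K = Q_2(sqrt a) = Q_2 + Q_2 sqrt a : every element can be
   written 2^(-qexp) * (qre + qim * sqrt a) with qre, qim in Z_2. *)
Record Kelt := mkKelt { qexp : nat; qre : Z2; qim : Z2 }.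

Definition Knonzero (z : Kelt) : Prop := exists i, qre z i || qim z i.

(* Arithmetic in Z[sqrt a] (pairs (u, v) = u + v sqrt a); reducing modulo
   2^n this is the arithmetic of Z_2[sqrt a] / 2^n. *)
Definition qmul (a : int) (p q : int * int) : int * int :=
  (p.1 * q.1 + a * (p.2 * q.2), p.1 * q.2 + p.2 * q.1).
Definition qpow (a : int) (p : int * int) (k : nat) : int * int :=
  iter k (qmul a p) (1, 0).
Definition qtrunc (n : nat) (z : Kelt) : int * int :=
  (Z2trunc n (qre z), Z2trunc n (qim z)).

(* sum_i c_i x_i^d = 0 in K = Q_2(sqrt a).  Writing c_i = 2^(-k_i) g_i and
   x_i = 2^(-l_i) h_i with g_i, h_i in Z_2[sqrt a], e_i = k_i + d l_i and
   E = max e_i, the sum is 2^(-E) * sum_i 2^(E - e_i) g_i h_i^d, and an element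
   of Z_2[sqrt a] = Z_2 + Z_2 sqrt a vanishes iff both coordinates vanish
   modulo 2^n for every n. *)
Definition additive_form_vanishes (a : int) (d s : nat)
    (c x : 'I_s -> Kelt) : Prop :=
  let e i := (qexp (c i) + d * qexp (x i))%N in
  let E := (\max_(i < s) e i)%N in
  forall n : nat,
    let t i := qmul a (qtrunc n (c i)) (qpow a (qtrunc n (x i)) d) in
    ((2 ^ n)%:Z %| \sum_(i < s) 2 ^+ (E - e i)%N * (t i).1)%Z /\
    ((2 ^ n)%:Z %| \sum_(i < s) 2 ^+ (E - e i)%N * (t i).2)%Z.

Definition all_forms_have_zero (a : int) (d s : nat) : Prop :=
  forall c : 'I_s -> Kelt,
    exists x : 'I_s -> Kelt,
      (exists i, Knonzero (x i)) /\ additive_form_vanishes a d c x.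

Definition Gamma_star_eq (a : int) (d N : nat) : Prop :=
  all_forms_have_zero a d N /\
  forall s, all_forms_have_zero a d s -> (N <= s)%N.

(* Main.v *)
From HB Require Import structures.
Require Import Defs.
From mathcomp Require Import all_boot all_order all_algebra.
From mathcomp Require Import zify ring.
From Stdlib Require Import Classical_Prop.
Set Implicit Arguments. Unset Strict Implicit. Unset Printing Implicit Defensive.
Import Order.TTheory GRing.Theory Num.Theory.
Local Open Scope ring_scope.

(** Write pi for a uniformizer of K. As m is odd, the d-th powers of units are
    the squares of units, which modulo pi^5 are 1 and (1 + pi)^2; a unit
    congruent to 1 modulo pi^5 is a d-th power. Hence a form has a nontrivial
    zero iff for some level k (a valuation modulo d) the variables of levels
    k, ..., k + 4, with 0, 1 or 1 + pi substituted for them and at least one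
    nonzero value at level k, give a sum divisible by pi^(k+5).

    Upper bounds: by the cycle lemma the levels can be numbered so that every
    initial segment holds at least its share of the variables. A search that
    runs through the levels, keeping for the last few levels the sums that
    can be reached from them, shows for a = -1, -5 that the surplus of
    variables over the number of levels stays bounded, although it grows by 1
    in each period; for a = 2, 10, -2, -10 it shows that the coefficient of pi
    in the last unit used flips every two levels, which contradicts the period
    2m as m is odd. The states of the search are ordered by inclusion, and
    finitely many of them cover all times.

    Lower bounds: for a = -1, -5 take the coefficients 1, pi, ..., pi^(d-1). In
    the other case take, for each q, three variables with coefficient pi^(2q)
    (q odd) or pi^(2q) (1 + pi) (q even), except that there is only one for
    q = m - 1, and one more variable with coefficient 1; already the levels
    k and k + 2 cannot produce a sum divisible by pi^(k+4). *)

(** * The quadratic order and its valuation at 2 *)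

(** The pairs are tagged with a so that they can carry the multiplication of Z[sqrt a] rather than
    the componentwise one. *)
Definition quad (a : int) : Type := (int * int)%type.

Section QuadRing.
Variable a : int.

HB.instance Definition _ := GRing.Zmodule.copy (quad a) (int * int)%type.

Let one : quad a := (1, 0).
Let mul (x y : quad a) : quad a := qmul a x y.

Fact quad_mulA : associative mul.
Proof. by move=> [x x'] [y y'] [z z']; congr pair => /=; ring. Qed.
Fact quad_mulC : commutative mul.
Proof. by move=> [x x'] [y y']; congr pair => /=; ring. Qed.
Fact quad_mul1 : left_id one mul.
Proof. by move=> [x x']; congr pair => /=; ring. Qed.
Fact quad_mulDl : left_distributive mul +%R.
Proof. by move=> [x x'] [y y'] [z z']; congr pair => /=; ring. Qed.
Fact quad_one_neq0 : one != 0.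
Proof. by []. Qed.

HB.instance Definition _ := GRing.Zmodule_isComNzRing.Build (quad a)
  quad_mulA quad_mulC quad_mul1 quad_mulDl quad_one_neq0.

Lemma quad_mulE (x y : quad a) : x * y = qmul a x y. Proof. by []. Qed.

Lemma qpowE (x : quad a) n : qpow a x n = x ^+ n.
Proof. by elim: n => [|n IH] //; rewrite exprS -IH. Qed.

Lemma quad_natE n : n%:R = (n%:Z, 0) :> quad a.
Proof.
elim: n => [|n IH] //; rewrite -natr1 IH; congr pair => /=.
by rewrite -[n.+1]addn1 PoszD.
Qed.

Definition norm (x : quad a) : int := x.1 ^+ 2 - a * x.2 ^+ 2.

Lemma normM x y : norm (x * y) = norm x * norm y.
Proof. by rewrite /norm /=; ring. Qed.

Lemma normN x : norm (- x) = norm x.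
Proof. by rewrite /norm /= !sqrrN. Qed.

Lemma norm_nat n : norm n%:R = (n ^ 2)%:Z.
Proof. by rewrite quad_natE /norm /= expr0n mulr0 subr0 expr2 -PoszM mulnn. Qed.

(* [V k x]: the valuation of x at the prime of Z[sqrt a] above 2 is at least k.
   That prime is totally ramified, so the norm computes the valuation. *)
Definition V k (x : quad a) : bool := ((2 ^ k)%:Z %| norm x)%Z.

Definition exact k (x : quad a) : bool := V k x && ~~ V k.+1 x.

End QuadRing.
Arguments V {a} k x.
Arguments exact {a} k x.
Arguments norm {a} x.

Lemma parityP (u : int) : exists p e, [/\ u = p * 2 + e & (e == 0) || (e == 1)].
Proof. by exists (u %/ 2)%Z, (u %% 2)%Z; split; lia. Qed.

Section Valuation.
Variable a : int.
Hypothesis Ha : ((a %% 4)%Z == 2) || ((a %% 4)%Z == 3).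
Implicit Types x y : quad a.

Lemma V0 x : V 0 x. Proof. by rewrite /V dvd1z. Qed.

Lemma Vzero k : V k (0 : quad a).
Proof. by rewrite /V /norm /= expr0n /= mulr0 subr0 dvdz0. Qed.

Lemma VN k x : V k (- x) = V k x.
Proof. by rewrite /V normN. Qed.

Lemma VM j k x y : V j x -> V k y -> V (j + k) (x * y).
Proof. by move=> jx ky; rewrite /V normM expnD PoszM dvdz_mul. Qed.

Lemma V_le j k x : (j <= k)%N -> V k x -> V j x.
Proof.
move=> jk; apply: dvdz_trans.
by rewrite -(subnK jk) expnD PoszM dvdz_mull.
Qed.


(** Modulo 4 the norm depends only on the parities of the coordinates and on a modulo 4; for a
    congruent to 2 or 3 it is divisible by 4 only when both coordinates are even. *)
Lemma V12E x :
  (V 1 x = ((x.1 + a * x.2)%R %% 2 == 0)%Z) /\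
  (V 2 x = ((x.1 %% 2 == 0) && (x.2 %% 2 == 0))%Z).
Proof.
rewrite /V /norm; move: x.1 x.2 => u v.
have [p [e [-> He]]] := parityP u; have [q [f [-> Hf]]] := parityP v.
have [b Hb] : exists b, a = b * 4 + (a %% 4)%Z by exists (a %/ 4)%Z; lia.
move: Ha Hb; set r := (a %% 4)%Z => Hr ->; clearbody r.
set N := _ - _; set M := p * 2 + e + _.
have -> : N = 4 * (p * p + p * e - b * (q * 2 + f) * (q * 2 + f)
                   - r * (q * q + q * f)) + (e * e - r * f * f).
  by rewrite /N; ring.
set A := (p * p + _ - _ - _).
have -> : M = 2 * (p + b * 2 * (q * 2 + f) + r * q) + (e + r * f).
  by rewrite /M; ring.
set B := (p + _ + _); clearbody A B.
by move: Hr He Hf => /orP[] /eqP-> /orP[] /eqP-> /orP[] /eqP->; lia.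
Qed.

Lemma V1E x : V 1 x = ((x.1 + a * x.2)%R %% 2 == 0)%Z.
Proof. by case: (V12E x). Qed.

Lemma V2E x : V 2 x = ((x.1 %% 2 == 0) && (x.2 %% 2 == 0))%Z.
Proof. by case: (V12E x). Qed.

Lemma Vdouble k x : V k.+2 (x * 2) = V k x.
Proof.
rewrite /V -[k.+2]addn2 normM norm_nat expnD PoszM.
by rewrite dvdz_mul2r.
Qed.

Lemma VSSE k x : V k.+2 x -> exists2 y, x = y * 2 & V k y.
Proof.
move=> Vx; have := V_le (isT : (2 <= k.+2)%N) Vx; rewrite V2E => /andP[e1 e2].
have xE : x = (((x.1 %/ 2)%Z, (x.2 %/ 2)%Z) : quad a) * 2.
  rewrite (quad_natE a 2) quad_mulE /qmul /=.
  by case: x e1 e2 {Vx} => u v /= e1 e2; congr pair; lia.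
by eexists; [exact: xE | rewrite -Vdouble -xE].
Qed.

(** The norm is not additive, so [VSSE] is used to descend to valuations 0 and 1, where parities
    settle the claim. *)
Lemma VD k x y : V k x -> V k y -> V k (x + y).
Proof.
elim/ltn_ind: k x y => -[_ x y _ _|[_ x y|k IH x y]]; first exact: V0.
  by rewrite !V1E /=; move: x.1 x.2 y.1 y.2 => u v u' v'; lia.
move=> /VSSE[x' -> Vx'] /VSSE[y' -> Vy'].
by rewrite -mulrDl Vdouble; apply: IH => //; rewrite ltnS leqnSn.
Qed.

Lemma VB k x y : V k x -> V k y -> V k (x - y).
Proof. by move=> Vx Vy; apply: VD => //; rewrite VN. Qed.

Lemma V_addl k x y : V k x -> V k (x + y) = V k y.
Proof.
move=> Vx; apply/idP/idP => [Vxy|]; last exact: VD.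
by rewrite -[y](addKr x) addrC; apply: VB.
Qed.

Lemma V_sub k x y : V k (x - y) -> V k x = V k y.
Proof. by move=> Vxy; rewrite -(V_addl y Vxy) subrK. Qed.

Lemma V_sum k (I : Type) (r : seq I) (P : pred I) (F : I -> quad a) :
  (forall i, P i -> V k (F i)) -> V k (\sum_(i <- r | P i) F i).
Proof.
by move=> VF; elim/big_ind: _ => //; [exact: Vzero|move=> *; exact: VD].
Qed.

Lemma VMl k x y : V k y -> V k (x * y).
Proof. exact: (@VM 0 k x y (V0 x)). Qed.

Lemma VMr k x y : V k x -> V k (x * y).
Proof. by rewrite mulrC; apply: VMl. Qed.

Lemma VX k n x : V k x -> V (k * n) (x ^+ n).
Proof.
move=> Vx; elim: n => [|n IH]; first by rewrite muln0 V0.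
by rewrite exprS mulnS VM.
Qed.

Lemma exactM j k x y : exact j x -> exact k y -> exact (j + k) (x * y).
Proof.
rewrite /exact /V => /andP[/dvdzP[p xE] nx] /andP[/dvdzP[q yE] ny].
have pos n : ((2 ^ n)%:Z != 0)%R by rewrite -lt0n expn_gt0.
have xyE : norm (x * y) = p * q * (2 ^ (j + k))%:Z.
  by rewrite normM xE yE mulrACA -PoszM -expnD.
rewrite xyE dvdz_mull //=; move: nx ny; rewrite xE yE.
rewrite !expnS !PoszM !dvdz_mul2r ?pos // => np nq.
have [p' [e [pE He]]] := parityP p; have [q' [f [qE Hf]]] := parityP q.
have [e1 f1] : e = 1 /\ f = 1 by lia.
have -> : p * q = 2 * (2 * p' * q' + p' + q') + 1.
  by rewrite pE qE e1 f1; ring.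
by lia.
Qed.

Lemma exact1 : exact 0 (1 : quad a).
Proof. by rewrite /exact V0 V1E /= mulr0 addr0. Qed.

Lemma exactX k n x : exact k x -> exact (k * n) (x ^+ n).
Proof.
move=> Ex; elim: n => [|n IH]; first by rewrite muln0 exact1.
by rewrite exprS mulnS exactM.
Qed.

Lemma V_cancel j k x y : exact j x -> V (j + k) (x * y) -> V k y.
Proof.
move=> Ex Vxy; elim: k Vxy => [|k IH] Vxy; first exact: V0.
have Vy : V k y by apply: IH; apply: V_le Vxy; rewrite leq_add2l.
apply/negPn/negP => nVy; have : exact k y by rewrite /exact Vy.
by move/(exactM Ex) => /andP[_]; rewrite -addnS Vxy.
Qed.

Lemma exactN k x : exact k (- x) = exact k x.
Proof. by rewrite /exact !VN. Qed.

(* The residue field has two elements. *)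
Lemma exactD k x y : exact k x -> exact k y -> V k.+1 (x + y).
Proof.
rewrite /exact; elim/ltn_ind: k x y => -[_ x y|[_ x y|k IH x y]].
- rewrite !V0 !V1E /=; move: x.1 x.2 y.1 y.2 => u v u' v'; lia.
- rewrite !V1E !V2E /=; case: x y => [u v] [u' v'] /=.
  have [b Hb] : exists b, a = b * 4 + (a %% 4)%Z by exists (a %/ 4)%Z; lia.
  have E (w : int) : (a * w = 2 * (2 * b * w) + (a %% 4)%Z * w)%R.
    by rewrite {1}Hb; ring.
  rewrite !E; set A := (2 * b * v); set B := (2 * b * v'); clearbody A B.
  by move: Ha => /orP[] /eqP->; lia.
move=> /andP[/VSSE[x' -> Vx'] nVx'] /andP[/VSSE[y' -> Vy'] nVy'].
rewrite -mulrDl Vdouble; apply: IH; rewrite ?ltnS ?leqnSn // ?Vx' ?Vy'.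
  by rewrite -[V k.+1 x']Vdouble.
by rewrite -[V k.+1 y']Vdouble.
Qed.

Lemma exact_sub k x y : V k.+1 (x - y) -> exact k x = exact k y.
Proof. by move=> Vxy; rewrite /exact !(V_sub (V_le _ Vxy)). Qed.

Lemma exact_mono k n x : exact k x -> V n x = (n <= k)%N.
Proof.
move=> /andP[Vx nVx]; apply/idP/idP => [Vn|nk]; last exact: V_le Vx.
by rewrite leqNgt; apply: contra nVx => kn; apply: V_le Vn.
Qed.

Lemma V_evenE n x :
  V (2 * n) x = ((2 ^ n)%:Z %| x.1)%Z && ((2 ^ n)%:Z %| x.2)%Z.
Proof.
elim: n x => [|n IH] x; first by rewrite V0 !dvd1z.
have E (y : quad a) : y * 2 = (y.1 * 2, y.2 * 2).
  by rewrite (quad_natE a 2) quad_mulE /qmul /=; congr pair; ring.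
rewrite mulnS expnS PoszM mulrC; apply/idP/idP.
  move=> /VSSE[y -> Vy]; rewrite E /= !dvdz_mul2r ?oner_eq0 //.
  by rewrite -IH.
move=> /andP[/dvdzP[u ux] /dvdzP[v vx]].
have -> : x = ((u * (2 ^ n)%:Z, v * (2 ^ n)%:Z) : quad a) * 2.
  by rewrite E /=; case: x ux vx => /= _ _ -> ->; rewrite !mulrA.
by rewrite Vdouble IH /= !dvdz_mull.
Qed.

Lemma exact_nat_odd n : odd n -> exact 0 (n%:R : quad a).
Proof. by move=> on; rewrite /exact V0 V1E quad_natE /= mulr0 addr0; lia. Qed.

Lemma exact2 : exact 2 (2 : quad a).
Proof. by rewrite /exact /V norm_nat. Qed.

Lemma V_subX j t n x y : V t x -> V t y -> V (t + j) (x - y) ->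
  V (t * n + j) (x ^+ n - y ^+ n).
Proof.
move=> Vx Vy Vxy; elim: n => [|n IH]; first by rewrite subrr Vzero.
have -> : x ^+ n.+1 - y ^+ n.+1 = x * (x ^+ n - y ^+ n) + (x - y) * y ^+ n.
  by rewrite !exprS; ring.
apply: VD => //; first by rewrite mulnS -addnA VM.
by rewrite mulnS -addnA [X in V (_ + X)]addnC addnA VM ?VX.
Qed.

Lemma V_trans k x y z : V k (x - y) -> V k (y - z) -> V k (x - z).
Proof.
by move=> H1 H2; have -> : x - z = (x - y) + (y - z) by [ring]; apply: VD.
Qed.

Lemma V_mul2l j k c x y : V j c -> V k (x - y) -> V (j + k) (c * x - c * y).
Proof. by rewrite -mulrBr; apply: VM. Qed.

(** A uniformizer: sqrt a for even a, 1 + sqrt a for odd a. *)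
Definition varpi : quad a := ((a %% 2)%Z, 1).

Lemma exact_varpi : exact 1 varpi.
Proof.
rewrite /exact V1E V2E /=.
by move: Ha => /orP[] /eqP H; lia.
Qed.

Lemma exact_varpiX k : exact k (varpi ^+ k).
Proof. by have := exactX k exact_varpi; rewrite mul1n. Qed.

(** Valuation at least 5 means 4 times an element of valuation at least 1; the parity criterion
    [V1E] is applied to the quotient. *)
Lemma V5E x : V 5 x = ((x.1 + a * x.2)%R %% 8 == 0)%Z && (x.2 %% 4 == 0)%Z.
Proof.
have E (y : quad a) : y * 2 = (y.1 * 2, y.2 * 2).
  by rewrite (quad_natE a 2) quad_mulE /qmul /=; congr pair; ring.
apply/idP/idP.
  move=> /VSSE[y -> /VSSE[z ->]]; rewrite !E V1E /= => H.
  have -> : z.1 * 2 * 2 + a * (z.2 * 2 * 2) = (z.1 + a * z.2) * 4 by ring.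
  move: H; set A := (z.1 + _)%R; clearbody A.
  by move: z.2 => v; lia.
move=> /andP[H1 H2].
have Hv : x.2 = (x.2 %/ 4)%Z * 2 * 2 by lia.
have Hu : x.1 = (x.1 %/ 4)%Z * 2 * 2.
  move: H1; rewrite Hv; move: (_ %/ 4)%Z => v.
  have -> : a * (v * 2 * 2) = (a * v) * 4 by ring.
  by set A := a * v; clearbody A; lia.
have -> : x = (((x.1 %/ 4)%Z, (x.2 %/ 4)%Z) : quad a) * 2 * 2.
  by rewrite !E /=; case: x Hv Hu {H1 H2} => /= u v <- <-.
rewrite !Vdouble V1E /=; move: H1; rewrite {1}Hu {1}Hv.
set v := (x.2 %/ 4)%Z; have -> : a * (v * 2 * 2) = (a * v) * 4 by ring.
by set A := a * v; clearbody A; lia.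
Qed.

End Valuation.
Arguments varpi a : clear implicits.

(** * Unit classes modulo varpi^5 *)

Section Residues.
Variable b : nat.
Definition rq := (nat * nat)%type.
Definition radd (p q : rq) : rq := ((p.1 + q.1) %% 8, (p.2 + q.2) %% 8)%N.
Definition rmul (p q : rq) : rq :=
  ((p.1 * q.1 + b * (p.2 * q.2)) %% 8, (p.1 * q.2 + p.2 * q.1) %% 8)%N.
Definition rvarpi : rq := (b %% 2, 1)%N.
Definition rsig : rq := rmul (radd (1, 0)%N rvarpi) (radd (1, 0)%N rvarpi).
Definition rsigX (e : bool) : rq := if e then rsig else (1, 0)%N.
Definition rpoly (cs : seq bool) : rq :=
  foldr (fun (c : bool) p => radd (nat_of_bool c, 0%N) (rmul rvarpi p)) (0, 0)%N cs.
(** The 32 values are in bijection with the residues modulo [varpi]^5; the moduli 8 and 4 are those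
    of [V5E]. *)
Definition rcode (p : rq) : rq := ((p.1 + b * p.2) %% 8, p.2 %% 4)%N.

(** The coefficient of [varpi] is the parity of k, which is why [odd] can serve as the colour of a
    class in the search. *)
Definition class_digits (k : nat) : seq bool :=
  [:: true; odd k; false; odd k./2; odd k./2./2].

(** Decided by computation on the 16 units modulo [varpi]^5: [sig] is its own inverse, every unit
    belongs to one of eight classes up to a factor [sig], and the square of a unit is 1 or [sig]. *)
Definition unit_facts : bool :=
  (rcode (rmul rsig rsig) == rcode (1, 0)%N) &&
  all (fun b1 => all (fun b2 => all (fun b3 => all (fun b4 =>
    let p := rpoly [:: true; b1; b2; b3; b4] in
    has (fun k => has (fun e : bool =>
        rcode p == rcode (rmul (rpoly (class_digits k)) (rsigX e)))
      [:: false; true]) (iota 0 8)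
    && has (fun e : bool => rcode (rmul p p) == rcode (rsigX e)) [:: false; true])
   [:: false; true]) [:: false; true]) [:: false; true]) [:: false; true].
End Residues.

Section Code.
Variable a : int.
Implicit Types x y : quad a.

Definition sig : quad a := (1 + varpi a) ^+ 2.

Definition vpoly (cs : seq bool) : quad a :=
  foldr (fun (c : bool) x => c%:R + varpi a * x) 0 cs.

(* Modulo varpi^5 and up to the factor [sig], these represent all units; the
   coefficient of varpi^2 is not needed because multiplying by [sig] flips it. *)
Definition kap (k : nat) : quad a := vpoly (class_digits k).

Definition amod8 : nat := `|(a %% 8)%Z|%N.

Definition red x : rq := (`|(x.1 %% 8)%Z|, `|(x.2 %% 8)%Z|)%N.

Definition code x : rq := rcode amod8 (red x).

Let modE (u : int) : (u %% 8)%Z = `|(u %% 8)%Z|%N.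
Proof. by rewrite gez0_abs // modz_ge0. Qed.

Let absE (u : int) (n : nat) : (u %% 8)%Z = n%:Z -> `|(u %% 8)%Z|%N = n.
Proof. by move->. Qed.

Lemma redD x y : red (x + y) = radd (red x) (red y).
Proof.
by congr pair; apply: absE; rewrite -modz_nat PoszD -!modE modzDm.
Qed.

Lemma redM x y : red (x * y) = rmul amod8 (red x) (red y).
Proof.
have mm (u v : int) : (((u %% 8)%Z * (v %% 8)%Z)%R %% 8)%Z = ((u * v)%R %% 8)%Z.
  by rewrite modzMml modzMmr.
congr pair; apply: absE; rewrite -modz_nat PoszD !PoszM /amod8 -!modE;
  rewrite -[LHS]modzDm -[RHS]modzDm; congr (((_ + _)%R %% 8)%Z).
- by rewrite modzMml modzMmr.
- by rewrite -(mm a) -(mm x.2) mm modzMml.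
- by rewrite modzMml modzMmr.
- by rewrite modzMml modzMmr.
Qed.

Lemma red_bool (e : bool) : red e%:R = (nat_of_bool e, 0%N).
Proof. by case: e. Qed.

Lemma red_varpi : red (varpi a) = rvarpi amod8.
Proof. by congr pair; rewrite /amod8 /=; lia. Qed.

Lemma red_vpoly cs : red (vpoly cs) = rpoly amod8 cs.
Proof.
by elim: cs => [|c cs IH] //; rewrite [LHS]redD redM red_bool red_varpi IH.
Qed.

Lemma red_sig : red sig = rsig amod8.
Proof. by rewrite /sig expr2 redM redD red_varpi. Qed.

Lemma red_sigX (e : bool) : red (sig ^+ e) = rsigX amod8 e.
Proof. by case: e; rewrite ?expr1 ?red_sig. Qed.

Hypothesis Ha : ((a %% 4)%Z == 2) || ((a %% 4)%Z == 3).

Lemma codeE x : code x = (`|((x.1 + a * x.2)%R %% 8)%Z|, `|(x.2 %% 4)%Z|)%N.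
Proof.
congr pair; last by rewrite /=; lia.
apply/esym/absE; rewrite -modz_nat PoszD PoszM /amod8 -!modE.
by rewrite -[LHS]modzDm -[RHS]modzDm modzMml modzMmr modz_mod.
Qed.

Lemma V5_code x y : V 5 (x - y) = (code x == code y).
Proof.
rewrite V5E // !codeE xpair_eqE /=.
have -> : x.1 - y.1 + a * (x.2 - y.2) = (x.1 + a * x.2) - (y.1 + a * y.2) by ring.
move: (x.1 + a * x.2) (y.1 + a * y.2) => u u'.
by move: x.2 y.2 => v v'; lia.
Qed.

Definition addc (p q : rq) : rq := ((p.1 + q.1) %% 8, (p.2 + q.2) %% 4)%N.

Lemma codeD x y : code (x + y) = addc (code x) (code y).
Proof.
rewrite !codeE /=.
have -> : x.1 + y.1 + a * (x.2 + y.2) = (x.1 + a * x.2) + (y.1 + a * y.2) by ring.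
by congr pair; rewrite /=; lia.
Qed.

End Code.
Arguments sig a : clear implicits.
Arguments vpoly a cs : clear implicits.
Arguments kap a k : clear implicits.

Definition ramified : seq int := [:: 2; 10; -2; -10; -1; -5].

Lemma ramified_mod4 a : a \in ramified -> ((a %% 4)%Z == 2) || ((a %% 4)%Z == 3).
Proof. by rewrite !inE => /or4P[|||/or3P[]] /eqP->. Qed.

Lemma ramified_unit_facts a : a \in ramified -> unit_facts (amod8 a).
Proof. by rewrite !inE => /or4P[|||/or3P[]] /eqP->; vm_compute. Qed.

Section Units.
Variable a : int.
Hypothesis Ra : a \in ramified.
Let Ha := ramified_mod4 Ra.
Implicit Types x y : quad a.

Lemma sig2 : V 5 (sig a ^+ 2 - 1).
Proof.
rewrite V5_code // /code expr2 redM red_sig.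
by case/andP: (ramified_unit_facts Ra).
Qed.

Lemma unit_classP b1 b2 b3 b4 :
  let x := vpoly a [:: true; b1; b2; b3; b4] in
  (exists k e, (k < 8)%N /\ V 5 (x - kap a k * sig a ^+ (e : bool)))
  /\ (exists e : bool, V 5 (x ^+ 2 - sig a ^+ e)).
Proof.
have mb (b : bool) : b \in [:: false; true] by case: b.
have /andP[_ /allP/(_ _ (mb b1))/allP/(_ _ (mb b2))] := ramified_unit_facts Ra.
move=> /allP/(_ _ (mb b3))/allP/(_ _ (mb b4))/andP[/hasP[k k8] /hasP[e _ He]].
move=> /hasP[e' _ He'] x; split; last first.
  by exists e'; rewrite V5_code // /code expr2 redM red_vpoly red_sigX.
exists k, e; split; first by move: k8; rewrite mem_iota.
by rewrite V5_code // /code redM !red_vpoly red_sigX.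
Qed.

Lemma digit k x : V k x -> exists b : bool, V k.+1 (x - b%:R * varpi a ^+ k).
Proof.
move=> Vx; case Vx1: (V k.+1 x); first by exists false; rewrite mul0r subr0.
exists true; rewrite mul1r; apply: exactD => //; first by rewrite /exact Vx Vx1.
by rewrite exactN //; apply: exact_varpiX.
Qed.

Lemma unit_digits k x : exact k x ->
  exists b1 b2 b3 b4, V (k + 5) (x - varpi a ^+ k * vpoly a [:: true; b1; b2; b3; b4]).
Proof.
move=> Ex; have V0x : V k.+1 (x - varpi a ^+ k).
  by apply: exactD => //; rewrite exactN //; apply: exact_varpiX.
have [b1 V1x] := digit V0x; have [b2 V2x] := digit V1x.
have [b3 V3x] := digit V2x; have [b4 V4x] := digit V3x.
exists b1, b2, b3, b4; move: V4x; rewrite !addnS addn0.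
by congr (V _ _); rewrite /= !exprS; ring.
Qed.

(** As [sig]^2 is 1 modulo [varpi]^5, raising squares of units to the odd power m does not change
    their residues. *)
Lemma sig_odd m : odd m -> V 5 (sig a ^+ m - sig a).
Proof.
move=> om; have -> : sig a ^+ m - sig a = sig a * ((sig a ^+ 2) ^+ m./2 - 1).
  by rewrite -{1}(odd_double_half m) om exprD expr1 -mul2n exprM mulrBr mulr1.
apply: VMl; rewrite -[X in _ - X](expr1n _ m./2).
by apply: (@V_subX a Ha 5 0); rewrite ?V0 ?sig2.
Qed.

Lemma sig_pow (e : bool) m : odd m -> V 5 ((sig a ^+ e) ^+ m - sig a ^+ e).
Proof.
by case: e => om; rewrite ?expr0 ?expr1 ?sig_odd // expr1n subrr Vzero.
Qed.

Lemma sig_addb (e f : bool) : V 5 (sig a ^+ e * sig a ^+ f - sig a ^+ (e (+) f)).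
Proof.
by case: e f => [] [] /=; rewrite ?mulr1 ?mul1r ?expr0 ?subrr ?Vzero // -expr2 sig2.
Qed.

Lemma exact_class k x : exact k x -> exists c e,
  (c < 8)%N /\ V (k + 5) (x - varpi a ^+ k * kap a c * sig a ^+ (e : bool)).
Proof.
move=> Ex; have [b1 [b2 [b3 [b4 Vx]]]] := unit_digits Ex.
have [[c [e [c8 Vc]]] _] := unit_classP b1 b2 b3 b4.
exists c, e; split => //; apply: (V_trans Ha Vx); rewrite -mulrA.
by apply: V_mul2l => //; case/andP: (exact_varpiX Ha k).
Qed.

Lemma exact_pow m k x : odd m -> exact k x -> exists e : bool,
  V (k * (2 * m) + 5) (x ^+ (2 * m) - varpi a ^+ (k * (2 * m)) * sig a ^+ e).
Proof.
move=> om Ex; have [b1 [b2 [b3 [b4 Vx]]]] := unit_digits Ex.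
have [_ [e Ve]] := unit_classP b1 b2 b3 b4; exists e.
have /andP[Vp _] := exact_varpiX Ha k.
apply: (V_trans Ha (V_subX Ha (2 * m) _ _ Vx)).
- by case/andP: Ex.
- by apply: VMr.
rewrite exprMn -exprM; apply: V_mul2l; first by case/andP: (exact_varpiX Ha (k * (2 * m))).
rewrite exprM; apply: (V_trans Ha _ (sig_pow e om)).
by apply: (@V_subX a Ha 5 0); rewrite ?V0.
Qed.

Lemma one_pi_pow m (e : bool) : odd m ->
  V 5 (((1 + varpi a) ^+ e) ^+ (2 * m) - sig a ^+ e).
Proof.
by move=> om; rewrite exprM (exprAC _ e 2); apply: sig_pow.
Qed.

End Units.

(** * Digit expansions *)

Lemma Z2truncS n x :
  Z2trunc n.+1 x = Z2trunc n x + (x n : nat)%:Z * 2 ^+ n.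
Proof. by rewrite /Z2trunc big_ord_recr. Qed.

Lemma pow2Z n : (2 ^ n)%:Z = 2 ^+ n :> int.
Proof. by rewrite -natz natrX. Qed.

Lemma Z2trunc_bounds n x : (0 <= Z2trunc n x < (2 ^ n)%:Z)%R.
Proof.
elim: n => [|n]; first by rewrite /Z2trunc big_ord0.
rewrite Z2truncS expnS PoszM -pow2Z; move: (Z2trunc n x) (2 ^ n)%N => u p.
by case: (x n) => /=; lia.
Qed.

Lemma Z2trunc_eq0 n x : Z2trunc n x = 0 -> forall i, (i < n)%N -> x i = false.
Proof.
elim: n => // n IH; rewrite Z2truncS => H i.
have := Z2trunc_bounds n x; rewrite -pow2Z in H.
have p0 : (0 < 2 ^ n)%N by rewrite expn_gt0.
case xn: (x n) H => /= H; first by move: (2 ^ n)%N p0 H => p; lia.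
move=> _; rewrite ltnS leq_eqVlt => /orP[/eqP->//|]; apply: IH.
by move: H; rewrite mul0r addr0.
Qed.

(** When the z n converge modulo 2^n, digit i is first determined by z (i+1); that integer need not
    lie in [0, 2^(i+1)), hence the quotient followed by the residue. *)
Definition bits (z : nat -> int) : Z2 :=
  fun i => (((z i.+1 %/ (2 ^ i)%:Z)%Z %% 2)%Z == 1).

Lemma Z2trunc_bits (z : nat -> int) :
  (forall n, ((2 ^ n)%:Z %| z n.+1 - z n)%Z) ->
  forall n, ((2 ^ n)%:Z %| Z2trunc n (bits z) - z n)%Z.
Proof.
move=> cz; elim=> [|n IH]; first by rewrite dvd1z.
have := rpredB IH (cz n); have := Z2trunc_bounds n (bits z).
rewrite Z2truncS -pow2Z expnS PoszM /bits; move: (Z2trunc n _) => u.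
have : (0 < 2 ^ n)%N by rewrite expn_gt0.
rewrite !dvdz_eq; move: (z n.+1) (z n) (2 ^ n)%N => w w' p p0 bu /eqP E.
(* The next integer differs from the truncation by q 2^n, and the parity of q is the new digit. *)
have {}E : exists q, w = u + q * p%:Z.
  exists (- ((u - w' - (w - w')) %/ p%:Z)%Z); move: E; set Q := (_ %/ _)%Z.
  by clearbody Q; move=> E; rewrite mulNr E; ring.
move: E => [q ->]; have -> : ((u + q * p%:Z) %/ p%:Z)%Z = q.
  by rewrite divzDr ?dvdz_mull // mulzK ?divz_small; lia.
apply/eqP; have -> : u + ((q %% 2)%Z == 1)%:Z * p%:Z - (u + q * p%:Z)
   = (((q %% 2)%Z == 1)%:Z - q) * p%:Z by ring.
have [q' [e [-> He]]] := parityP q.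
have -> : ((((q' * 2 + e) %% 2)%Z == 1)%:Z - (q' * 2 + e)) * p%:Z
   = - q' * (2 * p%:Z).
  by move: He => /orP[] /eqP->; rewrite ?addr0 ?modzMDl ?modzMl /=; ring.
by rewrite mulzK //; lia.
Qed.

Section Sequences.
Variable a : int.
Hypothesis Ha : ((a %% 4)%Z == 2) || ((a %% 4)%Z == 3).
Implicit Types (c x : Kelt) (z : nat -> quad a).

(** Such a sequence stands for an element of Z_2[sqrt a]; index n fixes it modulo 2^n, which has
    valuation 2n. *)
Definition coherent z := forall n, V (2 * n) (z n.+1 - z n).

Lemma coherent_le z : coherent z ->
  forall n n', (n <= n')%N -> V (2 * n) (z n' - z n).
Proof.
move=> cz n n' /subnK<-; elim: (n' - n)%N => [|k IH].
  by rewrite add0n subrr Vzero.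
apply: (V_trans Ha _ IH).
by rewrite addSn; apply: V_le (cz _); rewrite leq_mul2l leq_addl orbT.
Qed.

Definition kseq c (n : nat) : quad a := qtrunc n c.

Lemma coherent_kseq c : coherent (kseq c).
Proof.
move=> n; rewrite V_evenE //= !Z2truncS -!pow2Z.
by rewrite ![Z2trunc n _ + _]addrC !addrK !dvdz_mull.
Qed.

Definition of_seq z : Kelt := mkKelt 0 (bits (fst \o z)) (bits (snd \o z)).

Lemma of_seqP z : coherent z -> forall n, V (2 * n) (kseq (of_seq z) n - z n).
Proof.
move=> cz n; rewrite V_evenE //=; apply/andP; split; apply: Z2trunc_bits => k /=.
  by have := cz k; rewrite V_evenE // => /andP[].
by have := cz k; rewrite V_evenE // => /andP[].
Qed.

Lemma V_kseq_eq0 c n : V (2 * n) (kseq c n) -> forall i, (i < n)%N ->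
  qre c i || qim c i = false.
Proof.
rewrite V_evenE //= => /andP[d1 d2] i ltin.
have E (x : Z2) : ((2 ^ n)%:Z %| Z2trunc n x)%Z -> Z2trunc n x = 0.
  have := Z2trunc_bounds n x; move: (Z2trunc n x) => u b; rewrite dvdz_eq.
  move: (2 ^ n)%N b => p b /eqP E.
  by rewrite -E (divz_small (m := u)) ?mul0r //; lia.
by rewrite (Z2trunc_eq0 (E _ d1)) ?(Z2trunc_eq0 (E _ d2)).
Qed.

Lemma Knonzero_of_seq z n : coherent z -> ~~ V (2 * n) (z n) -> Knonzero (of_seq z).
Proof.
move=> cz; rewrite -(V_sub Ha (of_seqP cz n)) V_evenE // => nV.
suff /existsP[i Hi] : [exists i : 'I_n, qre (of_seq z) i || qim (of_seq z) i].
  by exists i.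
apply: contraNT nV; rewrite negb_exists => /forallP H.
by rewrite /= /Z2trunc !big1 ?dvdz0 // => i _;
  have := H i; rewrite negb_or /= => /andP[/negbTE e1 /negbTE e2];
  rewrite ?e1 ?e2 mul0r.
Qed.

Lemma kseq0 c : ~ Knonzero c -> forall n, kseq c n = 0.
Proof.
move=> nz n; have H i : qre c i = false /\ qim c i = false.
  case E: (qre c i || qim c i); first by case: nz; exists i.
  by move/negbT: E; rewrite negb_or => /andP[/negbTE-> /negbTE->].
by congr pair; rewrite /= /Z2trunc big1 // => i _; case: (H i) => H1 H2;
   rewrite ?H1 ?H2 mul0r.
Qed.

Lemma coherent_exact z n0 : coherent z -> ~~ V (2 * n0) (z n0) ->
  exists v, forall n, (n0 <= n)%N -> exact v (z n).
Proof.
move=> cz nV; have exn : exists k, ~~ V k.+1 (z n0).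
  by exists (2 * n0)%N; apply: contra nV; apply: V_le.
have minv := ex_minnP exn; case: minv => v nVv minv.
have Ev : exact v (z n0).
  rewrite /exact nVv andbT; case: (v) minv => [|v'] minv; first exact: V0.
  by apply/negPn/negP => /minv; rewrite ltnn.
exists v => n n0n; rewrite (exact_sub Ha (V_le _ (coherent_le cz n0n))) //.
rewrite ltnNge; apply: contra nVv => vn; move: nV.
by rewrite (exact_mono _ Ev) vn.
Qed.

Lemma Knonzero_exact c : Knonzero c ->
  exists v n0, forall n, (n0 <= n)%N -> exact v (kseq c n).
Proof.
move=> [i Hi]; have nV : ~~ V (2 * i.+1) (kseq c i.+1).
  by apply/negP => /V_kseq_eq0/(_ _ (ltnSn i)); rewrite Hi.
by have [v Hv] := coherent_exact (@coherent_kseq c) nV; exists v, i.+1.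
Qed.

Definition form_exp d s (c x : 'I_s -> Kelt) i := (qexp (c i) + d * qexp (x i))%N.

Lemma vanishesP d s (c x : 'I_s -> Kelt) :
  additive_form_vanishes a d c x <->
  forall n, V (2 * n) (\sum_i 2 ^+ ((\max_i form_exp d c x i) - form_exp d c x i)
     * kseq (c i) n * kseq (x i) n ^+ d).
Proof.
have S1 (F : 'I_s -> quad a) : (\sum_i F i).1 = \sum_i (F i).1.
  by elim/big_rec2: _ => // i u v _ <-.
have S2 (F : 'I_s -> quad a) : (\sum_i F i).2 = \sum_i (F i).2.
  by elim/big_rec2: _ => // i u v _ <-.
have E k (y : quad a) : 2 ^+ k * y = (2 ^+ k * y.1, 2 ^+ k * y.2).
  have -> : (2 ^+ k : quad a) = ((2 ^ k)%:Z, 0) by rewrite -natrX quad_natE.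
  by rewrite quad_mulE /qmul /= -pow2Z; congr pair; ring.
split=> [H n|H e0 E0 n t0].
  rewrite V_evenE // S1 S2; apply/andP; have [H1 H2] := H n.
  by split; [move: H1|move: H2]; congr (_ %| _)%Z; apply: eq_bigr => i _;
     rewrite -mulrA E quad_mulE -qpowE.
have := H n; rewrite V_evenE // S1 S2 => /andP[H1 H2].
by split; [move: H1|move: H2]; congr (_ %| _)%Z; apply: eq_bigr => i _;
     rewrite -mulrA E quad_mulE -qpowE.
Qed.

End Sequences.

(** * Lifting of approximate zeros *)

Section Hensel.
Variable a : int.
Hypothesis Ra : a \in ramified.
Let Ha := ramified_mod4 Ra.
Implicit Types x y h : quad a.

(** First-order expansion of the power: the remainder carries a factor h^2, which doubles the
    relative precision e. *)
Lemma V_taylor t e n x h : V t x -> V (t + e) h ->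
  V (t * n.+1 + 2 * e) ((x + h) ^+ n.+1 - x ^+ n.+1 - n.+1%:R * x ^+ n * h).
Proof.
move=> Vx Vh; have Vxh : V t (x + h) by apply: VD => //; apply: V_le Vh; apply: leq_addr.
elim: n => [|n IH]; first by rewrite !expr1 expr0 mulr1 mul1r -addrA -opprD subrr Vzero.
have -> : (x + h) ^+ n.+2 - x ^+ n.+2 - n.+2%:R * x ^+ n.+1 * h =
  (x + h) * ((x + h) ^+ n.+1 - x ^+ n.+1 - n.+1%:R * x ^+ n * h)
  + n.+1%:R * (x ^+ n * h ^+ 2).
  by rewrite -[n.+2%:R]natr1 ![_ ^+ n.+2]exprS ![x ^+ n.+1]exprS; ring.
apply: VD => //; first by rewrite mulnS -addnA VM.
apply: VMl; have -> : (t * n.+2 + 2 * e = t * n + (t + e) * 2)%N by lia.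
by rewrite VM ?VX.
Qed.

(** Since 2m has valuation 2, a change of X at relative position k - 2 changes the power exactly at
    relative position k, and as the residue field has two elements this removes the error. The
    remainder is harmless when 2(k - 2) >= k + 1, that is k >= 5. *)
Lemma hensel_step m v t k (C B X : quad a) : odd m -> (5 <= k)%N ->
  exact v C -> exact t X -> V (v + t * (2 * m) + k) (C * X ^+ (2 * m) + B) ->
  ~~ V (v + t * (2 * m) + k.+1) (C * X ^+ (2 * m) + B) ->
  V (v + t * (2 * m) + k.+1) (C * (X + varpi a ^+ (t + (k - 2))) ^+ (2 * m) + B).
Proof.
move=> om k5 EC EX VF nVF; set h := varpi a ^+ _.
have Eh : exact (t + (k - 2)) h := exact_varpiX Ha _.
have [n nE] : exists n, (2 * m = n.+1)%N.
  by exists (2 * m).-1; rewrite prednK //; case: (m) om.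
have EXn := exactX Ha n EX.
have Vr := V_taylor n (proj1 (andP EX)) (proj1 (andP Eh)).
move: Vr; set r := _ - _ - _ => Vr.
have -> : C * (X + h) ^+ (2 * m) + B =
   (C * X ^+ (2 * m) + B + C * ((2 * m)%:R * X ^+ n * h)) + C * r.
  by rewrite /r nE; ring.
apply: VD => //; last first.
  apply: (@V_le _ _ (v + (t * n.+1 + 2 * (k - 2)))); first by rewrite nE; lia.
  by apply: VM => //; case/andP: EC.
rewrite addnS; apply: exactD => //; first by rewrite /exact VF -addnS nVF.
have -> : (v + t * (2 * m) + k = v + ((2 + 0) + t * n + (t + (k - 2))))%N.
  by rewrite nE; lia.
do 3 (apply: exactM => //).
by rewrite natrM; apply: exactM => //; [exact: exact2 | exact: exact_nat_odd].
Qed.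

Section Lift.
Variables (m v t n0 : nat) (C B : nat -> quad a) (X0 : quad a).
Hypotheses (om : odd m) (cC : coherent C) (cB : coherent B).
Let w := (v + t * (2 * m))%N.
Hypothesis EC : forall n, (n0 <= n)%N -> exact v (C n).
Hypothesis EX0 : exact t X0.
Hypothesis VF0 : forall n, (n0 <= n)%N -> V (w + 5) (C n * X0 ^+ (2 * m) + B n).

(** Correction digit by digit: after k' steps the error has relative valuation at least 5 + k', so
    the change is made at 3 + k' above t. The index N is large enough to fix the coefficients modulo
    the tested power. *)
Fixpoint hensel_seq (k : nat) : quad a :=
  if k is k'.+1 then
    let y := hensel_seq k' in
    let N := (n0 + w + 6 + k')%N in
    if V (w + 6 + k') (C N * y ^+ (2 * m) + B N) then y else y + varpi a ^+ (t + 3 + k')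
  else X0.

Lemma hensel_seqP k : exact t (hensel_seq k) /\
  forall n, (n0 <= n)%N -> (w + 5 + k <= 2 * n)%N ->
    V (w + 5 + k) (C n * hensel_seq k ^+ (2 * m) + B n).
Proof.
elim: k => [|k [IH1 IH2]]; first by split=> // n ? _; rewrite addn0; apply: VF0.
have Vp : V (t + 3 + k) (varpi a ^+ (t + 3 + k)) by case/andP: (exact_varpiX Ha (t + 3 + k)).
split.
  rewrite /=; case: ifP => // _; rewrite (@exact_sub _ Ha _ _ (hensel_seq k)) //.
  by rewrite addrC addKr; apply: V_le Vp; lia.
suff H : let N := (n0 + w + 6 + k)%N in
    V (w + 5 + k.+1) (C N * hensel_seq k.+1 ^+ (2 * m) + B N).
  move=> n n0n wn; set N := (n0 + w + 6 + k)%N in H.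
  have cVs (z : nat -> quad a) : coherent z -> V (w + 5 + k.+1) (z n - z N).
    move=> cz; have [nN|Nn] := leqP n N.
      rewrite -VN opprB; apply: V_le (coherent_le Ha cz nN) => //.
    by apply: V_le (coherent_le Ha cz (ltnW Nn)); rewrite /N; lia.
  rewrite (@V_sub _ Ha _ _ (C N * hensel_seq k.+1 ^+ (2 * m) + B N)) //.
  have -> (y : quad a) : C n * y + B n - (C N * y + B N) = (C n - C N) * y + (B n - B N).
    by ring.
  by apply: VD => //; [apply: VMr|]; apply: cVs.
move=> N; rewrite /= -/N; have -> : (w + 5 + k.+1 = w + 6 + k)%N by lia.
case: ifP => // nVF.
have -> : (t + 3 + k = t + (5 + k - 2))%N by lia.
have -> : (w + 6 + k = w + (5 + k).+1)%N by lia.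
apply: hensel_step => //; first by apply: EC; rewrite /N; lia.
  by rewrite addnA; apply: IH2; rewrite /N; lia.
by rewrite -/w; have -> : (w + (5 + k).+1 = w + 6 + k)%N by [lia]; rewrite nVF.
Qed.

Lemma hensel : exists X : nat -> quad a,
  [/\ coherent X, (forall n, V (2 * n) (C n * X n ^+ (2 * m) + B n)) &
      exists n, ~~ V (2 * n) (X n)].
Proof.
have stepV k : V (t + 3 + k) (hensel_seq k.+1 - hensel_seq k).
  rewrite /=; case: ifP => _; first by rewrite subrr Vzero.
  by rewrite addrC addKr; case/andP: (exact_varpiX Ha (t + 3 + k)).
(* Index n asks for valuation 2n, hence every second term. *)
exists (fun n => hensel_seq (2 * n)); split.
- move=> n; rewrite mulnS; apply: (V_trans Ha).
    by apply: V_le (stepV (2 * n).+1); lia.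
  by apply: V_le (stepV (2 * n)%N); lia.
- move=> n; set y := hensel_seq _.
  set N := (n0 + n + w + 5 + 2 * n)%N.
  have [_ /(_ N)] := hensel_seqP (2 * n); rewrite -/y => H.
  have {}H : V (2 * n) (C N * y ^+ (2 * m) + B N).
    by apply: V_le (H _ _); rewrite /N; lia.
  have nN : (n <= N)%N by rewrite /N; lia.
  suff VB : V (2 * n) (C N * y ^+ (2 * m) + B N - (C n * y ^+ (2 * m) + B n)).
    by rewrite -(V_sub Ha VB).
  have -> : C N * y ^+ (2 * m) + B N - (C n * y ^+ (2 * m) + B n)
     = (C N - C n) * y ^+ (2 * m) + (B N - B n) by ring.
  by apply: VD => //; [apply: VMr|]; apply: coherent_le.
- exists t.+1; have [E _] := hensel_seqP (2 * t.+1).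
  by rewrite (exact_mono _ E); lia.
Qed.

End Lift.
End Hensel.

(** The residue of l - k modulo d; k * (d - 1) replaces -k so that no subtraction truncates. *)
Definition offset (d k l : nat) : nat := ((l + k * d.-1) %% d)%N.

Lemma offsetP d k l : (0 < d)%N -> (k + offset d k l = l %[mod d])%N.
Proof.
case: d => // d _; rewrite /offset /= modnDmr addnCA -mulnS.
by rewrite addnC modnMDl.
Qed.

Lemma offset_eq d k o l : (o < d)%N -> (k + o = l %[mod d])%N -> offset d k l = o.
Proof.
case: d => // d od E; rewrite /offset /=.
rewrite -modnDml -E modnDml addnAC -mulnS modnMDl.
by rewrite modn_small.
Qed.

Definition window_term (a : int) (o c : nat) (z : option bool) : quad a :=
  if z is Some e then varpi a ^+ o * kap a c * sig a ^+ (e : bool) else 0.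

(* A variable of level l (the valuation of its coefficient modulo d) and of
   unit class c, with the d-th power of a unit substituted for it, contributes
   at level k + offset; [z] records which variables take part and which of the
   two residues 1, [sig] of d-th powers of units is substituted. *)
Definition window_zero (a : int) (d s : nat) (l cl : 'I_s -> nat) : Prop :=
  exists (k : nat) (z : 'I_s -> option bool),
    [/\ exists i, z i != None /\ (l i = k %[mod d])%N,
        forall i, z i != None -> (offset d k (l i) < 5)%N
      & V 5 (\sum_i window_term a (offset d k (l i)) (cl i) (z i))].

Section WindowLift.
Variable a : int.
Hypothesis Ra : a \in ramified.
Let Ha := ramified_mod4 Ra.

Lemma exact_kap k : exact 0 (kap a k).
Proof.
rewrite (@exact_sub _ Ha _ _ 1) ?exact1 //.
rewrite /kap /class_digits /= addrC addKr; apply: VMr.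
by case/andP: (exact_varpi Ha).
Qed.

Lemma exact_one_varpi : exact 0 (1 + varpi a).
Proof.
rewrite (@exact_sub _ Ha _ _ 1) ?exact1 // addrC addKr.
by case/andP: (exact_varpi Ha).
Qed.

Lemma exact_sig (e : bool) : exact 0 (sig a ^+ e).
Proof. by have := exactX Ha e (exactX Ha 2 exact_one_varpi). Qed.

Lemma coherent_mulr (z : nat -> quad a) y : coherent z -> coherent (fun n => z n * y).
Proof. by move=> cz n; rewrite -mulrBl VMr. Qed.

Lemma coherent_mull (z : nat -> quad a) y : coherent z -> coherent (fun n => y * z n).
Proof. by move=> cz n; rewrite -mulrBr VMl. Qed.

Lemma coherent_sum (I : finType) (P : pred I) (z : I -> nat -> quad a) :
  (forall i, coherent (z i)) -> coherent (fun n => \sum_(i | P i) z i n).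
Proof. by move=> cz n; rewrite -sumrB; apply: V_sum => // i _; apply: cz. Qed.

Lemma coherent_const (y : quad a) : coherent (fun=> y).
Proof. by move=> n; rewrite subrr Vzero. Qed.

Definition int_coeff s (c : 'I_s -> Kelt) i n : quad a :=
  2 ^+ ((\max_i qexp (c i)) - qexp (c i)) * kseq a (c i) n.

Lemma coherent_coeff s (c : 'I_s -> Kelt) i : coherent (int_coeff c i).
Proof. exact: coherent_mull (coherent_kseq Ha (c i)). Qed.

(** The variables are scaled by powers of [varpi] to reach their places in the window; all of them
    then stay fixed except one of offset 0, which is lifted by [hensel]. *)
Lemma zero_of_window m s (c : 'I_s -> Kelt) (l cl : 'I_s -> nat) (ee : 'I_s -> bool) n0 :
  odd m ->
  (forall i n, (n0 <= n)%N -> V (l i + 5)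
     (int_coeff c i n - varpi a ^+ l i * kap a (cl i) * sig a ^+ ee i)) ->
  window_zero a (2 * m) l cl ->
  exists x, (exists i, Knonzero (x i)) /\ additive_form_vanishes a (2 * m) c x.
Proof.
move=> om; set d := (2 * m)%N => HC [k0 [z [[j [zj lj]] zo VS]]].
have d0 : (0 < d)%N by rewrite /d; case: (m) om.
(* Adding a multiple of d keeps the offsets and puts k above every level, so that the exponents t i
   are natural numbers. *)
pose k := (k0 + d * \sum_i l i)%N.
have offk i : offset d k (l i) = offset d k0 (l i).
  apply: offset_eq; first by rewrite ltn_mod.
  by rewrite /k addnAC addnC mulnC modnMDl offsetP.
pose o i := offset d k0 (l i); pose t i := ((k + o i - l i) %/ d)%N.
have tE i : (k + o i = l i + t i * d)%N.
  have le : (l i <= k + o i)%N.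
    apply: leq_trans (leq_addr _ _); apply: leq_trans (leq_addl _ _).
    rewrite (bigD1 i) //=; apply: leq_trans (leq_pmull _ d0).
    exact: leq_addr.
  have := offsetP k (l i) d0; rewrite offk => /eqP; rewrite eqn_mod_dvd //.
  by move=> dv; rewrite divnK // subnKC.
have oj : o j = 0%N.
  by apply: offset_eq => //; rewrite addn0 lj.
(* The coefficient already contributes [sig]^([ee] i), so the power has to supply the exponent e xor
   [ee] i. *)
pose X i : quad a := if z i is Some e
  then varpi a ^+ t i * (1 + varpi a) ^+ (e (+) ee i) else 0.
have EC i n : (n0 <= n)%N -> exact (l i) (int_coeff c i n).
  move=> n0n; rewrite (exact_sub Ha (V_le _ (HC i n n0n))); last by lia.
  have := exactM Ha (exactM Ha (exact_varpiX Ha (l i)) (exact_kap (cl i))) (exact_sig (ee i)).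
  by rewrite !addn0.
have VcX i n : (n0 <= n)%N -> V (k + 5)
    (int_coeff c i n * X i ^+ d - varpi a ^+ k * window_term a (o i) (cl i) (z i)).
  move=> n0n; rewrite /X /window_term; case: (z i) => [e|]; last first.
    by rewrite expr0n eqn0Ngt d0 !mulr0 subrr Vzero.
  apply: (@V_le _ _ (k + o i + 5)); first by lia.
  set u := (1 + varpi a) ^+ _; rewrite exprMn -exprM.
  have Vt : V (t i * d) (varpi a ^+ (t i * d)) by case/andP: (exact_varpiX Ha (t i * d)).
  have Vl : V (l i) (varpi a ^+ l i) by case/andP: (exact_varpiX Ha (l i)).
  (* Three replacements lead to the window term: the coefficient by its class, the power by its
     residue, and the product of two powers of [sig] by a single one. *)
  have H1 := VM (VM (HC i n n0n) Vt) (V0 (u ^+ d)).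
  have H2 : V (l i + t i * d + 5) (varpi a ^+ l i * kap a (cl i) * sig a ^+ ee i
     * varpi a ^+ (t i * d) * (u ^+ d - sig a ^+ (e (+) ee i))).
    apply: VM; last exact: one_pi_pow.
    by apply: VM => //; do 2 apply: VMr.
  have H3 : V (l i + t i * d + 5) (varpi a ^+ l i * kap a (cl i) * varpi a ^+ (t i * d)
     * (sig a ^+ ee i * sig a ^+ (e (+) ee i) - sig a ^+ (ee i (+) (e (+) ee i)))).
    apply: VM; last exact: sig_addb.
    by apply: VM => //; apply: VMr.
  have ebE : ee i (+) (e (+) ee i) = e by case: (e); case: (ee i).
  rewrite ebE in H3; rewrite tE.
  have {}H1 : V (l i + t i * d + 5) ((int_coeff c i n -
    varpi a ^+ l i * kap a (cl i) * sig a ^+ ee i) * varpi a ^+ (t i * d) * u ^+ d).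
    by move: H1; congr (V _ _); lia.
  move: (VD Ha (VD Ha H1 H2) H3); congr (V _ _).
  have -> : varpi a ^+ k * (varpi a ^+ o i * kap a (cl i) * sig a ^+ e)
    = varpi a ^+ l i * varpi a ^+ (t i * d) * kap a (cl i) * sig a ^+ e.
    by rewrite -exprD -tE exprD; ring.
  by ring.
pose B n := \sum_(i | i != j) int_coeff c i n * X i ^+ d.
have cB : coherent B.
  by apply: coherent_sum => i; apply: coherent_mulr; apply: coherent_coeff.
have EXj : exact (t j) (X j).
  rewrite /X; case: (z j) zj => // e _.
  have := exactM Ha (exact_varpiX Ha (t j)) (exactX Ha (e (+) ee j) exact_one_varpi).
  by rewrite mul0n addn0.
have kE : k = (l j + t j * d)%N by rewrite -tE oj addn0.
have sumV n : (n0 <= n)%N -> V (l j + t j * d + 5) (int_coeff c j n * X j ^+ d + B n).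
  move=> n0n; rewrite -kE.
  rewrite (@V_sub _ Ha _ _ (varpi a ^+ k *
     \sum_i window_term a (o i) (cl i) (z i))); last first.
    have -> : int_coeff c j n * X j ^+ d + B n = \sum_i int_coeff c i n * X i ^+ d.
      by rewrite [RHS](bigD1 j).
    rewrite mulr_sumr -sumrB.
    by apply: V_sum => // i _; apply: VcX.
  by apply: VM => //; case/andP: (exact_varpiX Ha k).
have [Y [cY VY [n1 nzY]]] :=
  hensel Ra om (coherent_coeff c j) cB (EC j) EXj sumV.
pose x i := if i == j then of_seq Y else of_seq (fun=> X i).
exists x; split; first by exists j; rewrite /x eqxx; apply: Knonzero_of_seq nzY.
apply/vanishesP => // n.
have xe i : qexp (x i) = 0%N by rewrite /x; case: ifP.
have fe i : form_exp d c x i = qexp (c i) by rewrite /form_exp xe muln0 addn0.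
rewrite (eq_bigr (fun i => int_coeff c i n * kseq a (x i) n ^+ d)); last first.
  by move=> i _; rewrite /int_coeff fe (eq_bigr (fun i => qexp (c i))).
rewrite (@V_sub _ Ha _ _ (int_coeff c j n * Y n ^+ d + B n)) //.
rewrite (bigD1 j) //= opprD addrACA; apply: VD => //.
  rewrite -mulrBr; apply: VMl; have := @V_subX _ Ha (2 * n) 0 d (kseq a (x j) n) (Y n).
  by apply; rewrite ?V0 // /x eqxx; apply: of_seqP.
rewrite /B -sumrB; apply: V_sum => // i /negbTE ij; rewrite -mulrBr; apply: VMl.
have := @V_subX _ Ha (2 * n) 0 d (kseq a (x i) n) (X i).
apply; rewrite ?V0 // /x ij.
exact: (of_seqP Ha (coherent_const (X i))).
Qed.

Lemma coeff_class s (c : 'I_s -> Kelt) i : Knonzero (c i) ->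
  exists q : nat * nat * bool * nat, (q.1.1.2 < 8)%N /\
   forall n, (q.2 <= n)%N -> V (q.1.1.1 + 5)
     (int_coeff c i n - varpi a ^+ q.1.1.1 * kap a q.1.1.2 * sig a ^+ q.1.2).
Proof.
move=> /(Knonzero_exact Ha)[v [n0 Hv]].
set N := (\max_i qexp (c i) - qexp (c i))%N.
have EC n : (n0 <= n)%N -> exact (2 * N + v) (int_coeff c i n).
  by move=> /Hv Ev; apply: exactM => //; apply: exactX => //; apply: exact2.
set w := (2 * N + v)%N in EC; pose n1 := (n0 + w + 5)%N.
have [cl [e [cl8 Vcl]]] := exact_class Ra (EC n1 ltac:(by rewrite /n1; lia)).
exists (w, cl, e, n1); split=> //= n n1n; apply: (V_trans Ha _ Vcl).
by apply: V_le (coherent_le Ha (coherent_coeff c i) n1n); rewrite /n1; lia.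
Qed.

Lemma all_forms_have_zero_of_window m s : odd m ->
  (forall l cl : 'I_s -> nat, (forall i, cl i < 8)%N -> window_zero a (2 * m) l cl) ->
  all_forms_have_zero a (2 * m) s.
Proof.
move=> om win c; set d := (2 * m)%N.
have d0 : (0 < d)%N by rewrite /d; case: (m) om.
have [[j nzj]|nz] := classic (exists j, ~ Knonzero (c j)).
  pose y i : quad a := if i == j then 1 else 0.
  exists (fun i => of_seq (fun=> y i)); split.
    exists j; apply: (@Knonzero_of_seq _ Ha _ 1); first exact: coherent_const.
    by rewrite /y eqxx (exact_mono _ (exact1 Ha)).
  apply/vanishesP => // n; apply: V_sum => // i _.
  have [->|/negbTE ij] := eqVneq i j; first by rewrite kseq0 // mulr0 mul0r Vzero.
  apply: VMl; have := of_seqP Ha (coherent_const (y i)) n.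
  rewrite /y ij subr0 => H; apply: V_le (VX d H); exact: leq_pmulr.
have nzc i : Knonzero (c i) by apply: NNPP => H; apply: nz; exists i.
have [q Hq] := fin_all_exists (fun i => coeff_class (nzc i)).
apply: (@zero_of_window m s c (fun i => (q i).1.1.1) (fun i => (q i).1.1.2)
   (fun i => (q i).1.2) (\max_i (q i).2)) => //.
  move=> i n Hn; have [_ H] := Hq i; apply: H; apply: leq_trans Hn.
  exact: leq_bigmax.
by apply: win => i; have [] := Hq i.
Qed.

End WindowLift.

(** * The search through the levels *)

Section Search.
Local Open Scope nat_scope.

(* A set of codes is the list of its 32 membership bits, in the order of
   [code_index]; a shift by a code c is the list of the indices of g - c. *)
Definition bitset := seq bool.
Definition code_index (g : rq) : nat := 4 * g.1 + g.2.
Definition codes : seq rq := [seq (x, y) | x <- iota 0 8, y <- iota 0 4].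
Definition subc (g c : rq) : rq := addc g (8 - c.1, 4 - c.2).
Definition shift (c : rq) : seq nat := [seq code_index (subc g c) | g <- codes].
Definition shifts := (seq nat * seq nat)%type.

Definition mem_code (A : bitset) (g : rq) := nth false A (code_index g).

(** Index 0 belongs to the zero code, so it signals g = c, the variable taken alone. The empty sum
    is not put into the sets, as a variable of the starting level must take part. *)
Definition add_primary (c : shifts) (A : bitset) : bitset :=
  [seq if q.1 then true else if q.2.1 is 0 then true else
       if q.2.2 is 0 then true else
       if nth false A q.2.1 then true else nth false A q.2.2
  | q <- zip A (zip c.1 c.2)].

Definition add_secondary (c : shifts) (A : bitset) : bitset :=
  [seq if q.1 then true else if nth false A q.2.1 then true else nth false A q.2.2
  | q <- zip A (zip c.1 c.2)].

Variables (T : nat -> seq shifts) (colour : nat -> bool).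
(** The surplus is [den] times the number of variables minus [num] times the number of levels
    passed; it has to be at least [off] after each level. *)
Variables (num den off : nat).

(* The sets of codes reached from each of the last five levels at which a
   window may start (the current level first), the surplus of variables, and
   the colour of the last variable. *)
Definition node := (seq bitset * nat * bool)%type.

(** Window j started j levels ago, so the new variable has offset j in it and is primary only for j
    = 0. [None] records that the zero code, at the head of a set, has been reached. *)
Fixpoint add_sets (add : shifts -> bitset -> bitset) (r : seq shifts) (ss : seq bitset) :
    option (seq bitset) :=
  if (r, ss) is (c :: r', A :: ss') then
    let A' := add c A in
    if head false A' then None
    else if add_sets add_secondary r' ss' is Some ss'' then Some (A' :: ss'') else None
  else Some [::].

Definition addvar (k : nat) (nd : node) : option node :=
  if add_sets add_primary (T k) nd.1.1 is Some ss
  then Some (ss, nd.1.2 + den, colour k) else None.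

(** Divisibility of codes by [varpi], ..., [varpi]^4, where [varpi]^2 amounts to a factor 2. *)
Definition masks : seq bitset :=
  [seq [seq (m.1 %| g.1) && (m.2 %| g.2) | g <- codes]
  | m <- [:: (2, 1); (2, 2); (4, 2); (4, 4)]].

(* From level k + j on, only sums divisible by varpi^(j+1) can still become
   zero modulo varpi^5; the other codes are dropped. *)
Definition prune (ms ss : seq bitset) : seq bitset :=
  [seq [seq p.1 && p.2 | p <- zip q.1 q.2] | q <- zip ms ss].

(** As there are four masks, pruning also drops the oldest of the five windows; the new window
    starts empty. *)
Definition advance (ms : seq bitset) (nd : node) : option node :=
  if num + off <= nd.1.2
  then Some (nseq 32 false :: prune ms nd.1.1, nd.1.2 - num, nd.2) else None.

Fixpoint repeat_class f k (cont : node -> seq (option node)) nd : seq (option node) :=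
  if f is f'.+1 then
    cont nd ++ (if addvar k nd is Some nd' then repeat_class f' k cont nd' else [::])
  else [:: None].

(* All nodes obtained by adding the variables of one level, sorted by class;
   [None] marks a class used eight times. *)
Fixpoint explore (ks : seq nat) (nd : node) : seq (option node) :=
  if ks is k :: ks' then repeat_class 8 k (explore ks') nd else [:: Some nd].

Definition successors (nd : node) : seq (option node) :=
  let ms := masks in
  pmap (fun o => if o is Some nd' then omap Some (advance ms nd') else Some None)
    (explore (iota 0 8) nd).

(** Fewer reachable codes and a larger surplus allow more continuations, so y need not be followed
    once x is. *)
Definition subsumes (x y : node) : bool :=
  [&& y.1.2 <= x.1.2, x.2 == y.2 & all2 (all2 implb) x.1.1 y.1.1].

Definition covered (X : seq node) (o : option node) : bool :=
  if o is Some y then has (subsumes^~ y) X else false.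

Definition covers (X Y : seq node) : bool :=
  all (fun x => all (covered Y) (successors x)) X.

Definition reduce (X : seq node) : seq node :=
  foldl (fun Y x => if has (subsumes^~ x) Y then Y
                    else x :: [seq y <- Y | ~~ subsumes x y]) [::] X.

Definition next_layer (X : seq node) : seq node :=
  reduce (pmap id (flatten (map successors X))).

Definition init_layer : seq node := [:: (nseq 5 (nseq 32 false), 0, false)].

Fixpoint layers n X : seq (seq node) :=
  if n is n'.+1 then X :: layers n' (next_layer X) else [:: X].

(* When this holds, layer 6 covers all later even times and layer 7 all later
   odd ones. *)
Definition closed_search (final : seq node -> bool) : bool :=
  let L := layers 7 init_layer in
  [&& sorted covers L, covers (nth [::] L 7) (nth [::] L 6) & final (nth [::] L 6)].

Definition surplus_at_most n (X : seq node) : bool := all (fun x => x.1.2 <= n) X.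

Definition colour_alternates (X : seq node) : bool :=
  all (fun x => all (fun o => if o is Some y then
      all (fun o' => if o' is Some z then z.2 != x.2 else false) (successors y)
    else false) (successors x)) X.

End Search.

(** * The codes of the variables and the two computations *)

Section Table.
Local Open Scope nat_scope.
Variable b : nat.
Definition rvarpiX j := iter j (rmul b (rvarpi b)) (1, 0).
Definition entry j k e : rq :=
  rcode b (rmul b (rmul b (rvarpiX j) (rpoly b (class_digits k))) (rsigX b e)).
Definition class_row k := [seq (shift (entry j k false), shift (entry j k true)) | j <- iota 0 5].
Definition table := [seq class_row k | k <- iota 0 8].
End Table.

Definition tabrow (t : seq (seq shifts)) k := nth [::] t k.

(** For d + 1 variables on d levels: one variable per level is subtracted, and a surplus of 1 must
    remain. The bound 9 holds in layer 6, hence at all later even times. *)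
Lemma search_odd b : b \in [:: 3; 7]%N ->
  closed_search (tabrow (table b)) xpred0 1 1 1 (surplus_at_most 9).
Proof. by rewrite !inE => /orP[] /eqP->; vm_compute. Qed.

(** For 3m variables on 2m levels, on average 3/2 per level. The final condition says that two
    levels after any node of layer 6 the colour has flipped. *)
Lemma search_even b : b \in [:: 2; 6]%N ->
  closed_search (tabrow (table b)) odd 3 2 0 (colour_alternates (tabrow (table b)) odd 3 2 0).
Proof. by rewrite !inE => /orP[] /eqP->; vm_compute. Qed.

(** * Soundness of the search *)

Section SearchRun.
Local Open Scope nat_scope.
Variables (T : nat -> seq shifts) (colour : nat -> bool) (den : nat).

Fixpoint run (ks : seq nat) (nd : node) : option node :=
  if ks is k :: ks' then obind (run ks') (addvar T colour den k nd) else Some nd.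

Lemma run_cat ks ks' nd : run (ks ++ ks') nd = obind (run ks') (run ks nd).
Proof. by elim: ks nd => //= k ks IH nd; case: addvar => //= x; rewrite IH. Qed.

Lemma explore_run (n : nat -> nat) ks nd nd' :
  run (flatten [seq nseq (n k) k | k <- ks]) nd = Some nd' ->
  (Some nd' \in explore T colour den ks nd) || (None \in explore T colour den ks nd).
Proof.
elim: ks nd => [|k ks IH] nd; first by move=> [->]; rewrite mem_head.
change (explore T colour den (k :: ks) nd)
  with (repeat_class T colour den 8 k (explore T colour den ks) nd).
rewrite [map _ _]/= [flatten _]/= run_cat; move: (n k) => p; elim: 8 p nd => [|f IHf] p nd.
  by move=> _; apply/orP; right; apply: mem_head.
rewrite /= !mem_cat; case: p => [|p] /=.
  by move=> /IH/orP[]->; rewrite ?orbT.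
case: (addvar _ _ _ k nd) => //= nd1 /IHf/orP[]->; rewrite ?orbT //.
Qed.

Lemma add_setsP add r ss :
  let add_at j := if j is 0 then add else add_secondary in
  if add_sets add r ss is Some ss' then
    forall j, nth [::] ss' j = [::] \/ [/\ j < size r, j < size ss &
      nth [::] ss' j = add_at j (nth ([::], [::]) r j) (nth [::] ss j)]
  else exists j, [/\ j < size r, j < size ss &
     head false (add_at j (nth ([::], [::]) r j) (nth [::] ss j))].
Proof.
elim: r add ss => [|c r IH] add [|A ss] //=; try by move=> j; left; rewrite nth_nil.
case: ifP => [hA|_]; first by exists 0.
move: (IH add_secondary ss); case: add_sets => [ss'|] H.
  by case=> [|j] /=; [right|case: (H j) => [->|]; [left|case: j => *; right]].
by case: H => -[|j] H; [exists 1|exists j.+2].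
Qed.

Lemma subsumes_mem x y j g : subsumes x y ->
  mem_code (nth [::] x.1.1 j) g -> mem_code (nth [::] y.1.1 j) g.
Proof.
have E (A B : bitset) i : all2 implb A B -> nth false A i -> nth false B i.
  by elim: A B i => [|u A IH] [|v B] [|i] //= /andP[/implyP uv AB] //; apply: IH.
move=> /and3P[_ _]; rewrite /mem_code.
elim: (x.1.1) (y.1.1) j => [|A xs IH] [|B ys] [|j] //= /andP[AB xy]; last exact: IH.
exact: E.
Qed.

End SearchRun.

Lemma perm_by_class (I : eqType) (f : I -> nat) n (r : seq I) :
  perm_eq (flatten [seq [seq x <- r | f x == k] | k <- iota 0 n])
          [seq x <- r | f x < n]%N.
Proof.
elim: n => [|n IH]; first by rewrite /= (eq_filter (a2 := pred0)) ?filter_pred0.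
rewrite -addn1 iotaD map_cat flatten_cat /= cats0 add0n.
apply/permP => P; rewrite count_cat (permP IH) !count_filter addn1.
by elim: r {IH} => //= x r; case: (P x); case: ltngtP; lia.
Qed.

Lemma map_by_class (I : eqType) (f : I -> nat) n (r : seq I) :
  map f (flatten [seq [seq x <- r | f x == k] | k <- iota 0 n])
  = flatten [seq nseq (count (fun x => f x == k) r) k | k <- iota 0 n].
Proof.
rewrite map_flatten -map_comp; congr flatten; apply: eq_map => k /=.
elim: r => //= x r IH; case: eqP => [E|_] /=; last exact: IH.
by rewrite E IH.
Qed.

Section Codes.
Local Open Scope nat_scope.

Definition valid (g : rq) := (g.1 < 8) && (g.2 < 4).

Lemma valid_subc g c : valid (subc g c).
Proof. by rewrite /valid /= !ltn_mod. Qed.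

Lemma subcK g c : valid g -> valid c -> addc c (subc g c) = g.
Proof.
case: g c => [x y] [x' y'] /andP[/= x8 y4] /andP[/= x8' y4'].
by rewrite /addc /=; congr pair; lia.
Qed.

Lemma code_index_inj g h : valid g -> valid h -> code_index g = code_index h -> g = h.
Proof.
rewrite /code_index; case: g h => [x y] [x' y'] /andP[/= ? ?] /andP[/= ? ?] E.
by congr pair; lia.
Qed.

Lemma nth_shift g c : valid g -> nth 0 (shift c) (code_index g) = code_index (subc g c).
Proof.
case: g => x y /andP[/= x8 y4]; rewrite /shift (nth_map (0, 0)).
  congr (code_index (subc _ _)).
  have: all (fun x => all (fun y => nth (0, 0) codes (code_index (x, y)) == (x, y))
    (iota 0 4)) (iota 0 8) by [].
  by move=> /allP/(_ x); rewrite mem_iota => /(_ x8)/allP/(_ y); rewrite mem_iota => /(_ y4)/eqP.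
by rewrite /code_index /=; lia.
Qed.

Lemma mem_add_secondary g c1 c2 A : valid g ->
  mem_code (add_secondary (shift c1, shift c2) A) g ->
  [|| mem_code A g, mem_code A (subc g c1) | mem_code A (subc g c2)].
Proof.
move=> vg; rewrite /mem_code /add_secondary; set i := code_index g.
have [lt|ge] := ltnP i (size (zip A (zip (shift c1) (shift c2)))); last first.
  by rewrite nth_default ?size_map.
by rewrite (nth_map (false, (0, 0))) // nth_zip_cond lt nth_zip //= !nth_shift.
Qed.

Lemma mem_add_primary g c1 c2 A : valid g -> valid c1 -> valid c2 ->
  mem_code (add_primary (shift c1, shift c2) A) g ->
  [|| g == c1, g == c2, mem_code A g, mem_code A (subc g c1) | mem_code A (subc g c2)].
Proof.
move=> vg vc1 vc2; rewrite /mem_code /add_primary; set i := code_index g.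
have [lt|ge] := ltnP i (size (zip A (zip (shift c1) (shift c2)))); last first.
  by rewrite nth_default ?size_map.
have E0 c : valid c -> code_index (subc g c) = 0 -> g == c.
  move=> vc E; rewrite -(subcK vg vc) (_ : subc g c = (0, 0)).
    by case: c vc {E} => x y /andP[/= ? ?]; rewrite /addc /= !addn0 !modn_small.
  by apply: code_index_inj; rewrite ?valid_subc // E.
rewrite (nth_map (false, (0, 0))) // nth_zip_cond lt nth_zip //= !nth_shift //.
case: (nth _ A i); first by rewrite !orbT.
case E1: (code_index (subc g c1)) => [|n1]; first by rewrite E0.
case E2: (code_index (subc g c2)) => [|n2]; first by rewrite (E0 c2) ?orbT.
by case: (nth false A n1.+1); case: (nth false A n2.+1); rewrite ?orbT.
Qed.

End Codes.

Section SearchSound.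
Variables (a : int) (d s : nat) (l cl : 'I_s -> nat).
Hypothesis Ra : a \in ramified.
Hypothesis d6 : (6 <= d)%N.
Hypothesis cl8 : forall i, (cl i < 8)%N.
Hypothesis no_zero : ~ window_zero a d l cl.
Let Ha := ramified_mod4 Ra.
Let d0 : (0 < d)%N. Proof. by lia. Qed.

Definition window_sum k (z : 'I_s -> option bool) : quad a :=
  \sum_i window_term a (offset d k (l i)) (cl i) (z i).

Definition reach k (P : pred 'I_s) (g : rq) := exists z : 'I_s -> option bool,
  [/\ exists i, z i != None /\ (l i = k %[mod d])%N, forall i, z i != None -> P i
    & code (window_sum k z) = g].

Lemma reach_sub k (P Q : pred 'I_s) g : subpred P Q -> reach k P g -> reach k Q g.
Proof. by move=> PQ [z [zk zP zg]]; exists z; split=> // i /zP/PQ. Qed.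

Lemma reach_nonzero k (P : pred 'I_s) : (forall i, P i -> (offset d k (l i) < 5)%N) ->
  ~ reach k P (0, 0)%N.
Proof.
move=> P5 [z [zk zP zg]]; apply: no_zero; exists k, z; split=> //.
  by move=> i /zP/P5.
by rewrite -/(window_sum k z) -[window_sum k z]subr0 V5_code // zg /code /rcode /= muln0.
Qed.

Definition vcode k i e : rq := code (window_term a (offset d k (l i)) (cl i) (Some e)).

Lemma valid_code (x : quad a) : valid (code x).
Proof. by rewrite /valid /code /rcode /= !ltn_mod. Qed.

Lemma reach_add k (P Q : pred 'I_s) g i e : ~~ P i -> Q i -> subpred P Q ->
  reach k P g -> reach k Q (addc (vcode k i e) g).
Proof.
move=> nPi Qi PQ [z [[j [zj lj]] zP zg]].
have zi : z i = None by apply/eqP; apply: contraNT nPi => /zP.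
exists (fun j => if j == i then Some e else z j); split.
- by exists j; split=> //; case: (j =P i) zj => // ->; rewrite zi.
- by move=> q; case: (q =P i) => [->|_ /zP/PQ].
rewrite -zg /window_sum (bigD1 i) //= [in RHS](bigD1 i) //= zi add0r eqxx codeD //.
by congr (addc _ (code _)); apply: eq_bigr => q /negbTE->.
Qed.

Lemma reach_primary k (Q : pred 'I_s) i e : Q i -> (l i = k %[mod d])%N ->
  reach k Q (vcode k i e).
Proof.
move=> Qi li; exists (fun j => if j == i then Some e else None); split.
- by exists i; rewrite eqxx.
- by move=> q; case: (q =P i) => [->|].
rewrite /window_sum (bigD1 i) //= eqxx big1 ?addr0 // => q /negbTE-> //.
Qed.

(** An inclusion and not an equality, so that it survives the dropping of codes by [prune] and
    [subsumes]. *)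
Definition sound k (P : pred 'I_s) (A : bitset) :=
  forall g, valid g -> mem_code A g -> reach k P g.

Lemma sound_secondary k (P Q : pred 'I_s) i A : ~~ P i -> Q i -> subpred P Q ->
  sound k P A ->
  sound k Q (add_secondary (shift (vcode k i false), shift (vcode k i true)) A).
Proof.
move=> nPi Qi PQ sA g vg /(mem_add_secondary vg)/or3P[] Ag.
- exact: reach_sub PQ (sA _ vg Ag).
- rewrite -(subcK vg (valid_code _ : valid (vcode k i false))).
  by apply: reach_add nPi Qi PQ _; apply: sA (valid_subc _ _) Ag.
- rewrite -(subcK vg (valid_code _ : valid (vcode k i true))).
  by apply: reach_add nPi Qi PQ _; apply: sA (valid_subc _ _) Ag.
Qed.

Lemma sound_primary k (P Q : pred 'I_s) i A : ~~ P i -> Q i -> subpred P Q ->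
  (l i = k %[mod d])%N -> sound k P A ->
  sound k Q (add_primary (shift (vcode k i false), shift (vcode k i true)) A).
Proof.
move=> nPi Qi PQ li sA g vg.
move=> /(mem_add_primary vg (valid_code _) (valid_code _))/or3P[/eqP->|/eqP->|].
- exact: reach_primary.
- exact: reach_primary.
move=> /or3P[] Ag.
- exact: reach_sub PQ (sA _ vg Ag).
- rewrite -(subcK vg (valid_code _ : valid (vcode k i false))).
  by apply: reach_add nPi Qi PQ _; apply: sA (valid_subc _ _) Ag.
- rewrite -(subcK vg (valid_code _ : valid (vcode k i true))).
  by apply: reach_add nPi Qi PQ _; apply: sA (valid_subc _ _) Ag.
Qed.

Definition used L (p : seq 'I_s) k : pred 'I_s :=
  fun i => (offset d k (l i) < L - k)%N || (i \in p).

Definition sound_sets L p (ss : seq bitset) :=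
  forall j, (j < 5)%N -> sound (L - j) (used L p (L - j)) (nth [::] ss j).

Let T := tabrow (table (amod8 a)).

Lemma T_nth i j L : (j < 5)%N -> (j <= L)%N -> (l i = L %[mod d])%N ->
  nth ([::], [::]) (T (cl i)) j =
  (shift (vcode (L - j) i false), shift (vcode (L - j) i true)).
Proof.
move=> j5 jL li; have oj : offset d (L - j) (l i) = j.
  by apply: offset_eq; [lia | rewrite subnK].
rewrite /T /tabrow /table (nth_map 0%N) ?size_iota // nth_iota // add0n.
rewrite /class_row (nth_map 0%N) ?size_iota // nth_iota // add0n /vcode oj.
have red_varpiX n : red (varpi a ^+ n) = rvarpiX (amod8 a) n.
  elim: n => [|n IH]; first exact: (red_bool a true).
  by rewrite exprS redM red_varpi IH.
have E e : entry (amod8 a) j (cl i) e = code (window_term a j (cl i) (Some e)).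
  by rewrite /window_term /code !redM red_varpiX red_vpoly red_sigX.
by rewrite !E.
Qed.

Variables (colour : nat -> bool) (num den off : nat).

Lemma offset_level L k i : (k <= L < k + 5)%N -> (l i = L %[mod d])%N ->
  offset d k (l i) = (L - k)%N.
Proof. by move=> kL li; apply: offset_eq; [lia|rewrite subnKC //; lia]. Qed.

(** [addvar] fails only when the zero code is reached in some window, and by [reach_nonzero] this
    would be a zero of the form. *)
Lemma addvar_sound L p i nd : (4 <= L)%N -> (l i = L %[mod d])%N -> i \notin p ->
  (forall q, q \in p -> (l q = L %[mod d])%N) ->
  sound_sets L p nd.1.1 ->
  exists nd', addvar T colour den (cl i) nd = Some nd' /\
    [/\ sound_sets L (i :: p) nd'.1.1, nd'.1.2 = (nd.1.2 + den)%N & nd'.2 = colour (cl i)].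
Proof.
move=> L4 li ip lp snd.
have nU k : (k <= L < k + 5)%N -> ~~ used L p k i.
  by move=> kL; rewrite /used (offset_level kL li) ltnn.
have U' k : used L (i :: p) k i by rewrite /used mem_head orbT.
have sU k : subpred (used L p k) (used L (i :: p) k).
  by move=> q; rewrite /used inE => /orP[]->; rewrite ?orbT.
have U5 k : (k <= L < k + 5)%N -> forall q, used L (i :: p) k q -> (offset d k (l q) < 5)%N.
  move=> kL q /orP[|]; first by lia.
  move=> qp; rewrite (offset_level kL) //; first by lia.
  by move: qp; rewrite inE => /orP[/eqP->|/lp].
have snd' j : (j < 5)%N -> sound (L - j) (used L (i :: p) (L - j))
   ((if j is 0 then add_primary else add_secondary)
      (nth ([::], [::]) (T (cl i)) j) (nth [::] nd.1.1 j)).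
  move=> j5; rewrite (T_nth j5 _ li); last by lia.
  case: j j5 => [|j] j5.
    by apply: sound_primary (snd 0%N j5) => //; rewrite ?subn0 //; apply: nU; lia.
  by apply: sound_secondary (snd j.+1 j5) => //; apply: nU; lia.
have sT : (size (T (cl i)) <= 5)%N.
  rewrite /T /tabrow /table; case: (ltnP (cl i) 8) (cl8 i) => // c8 _.
  by rewrite (nth_map 0%N) ?size_iota // size_map size_iota.
rewrite /addvar; have := add_setsP add_primary (T (cl i)) nd.1.1.
case: add_sets => [ss'|] /= H.
  eexists; split; [by []|split => //= j j5].
  have [->|[_ _ ->]] := H j; first by move=> g _; rewrite /mem_code nth_nil.
  exact: snd'.
case: H => j [js _ hd]; have j5 : (j < 5)%N by apply: leq_trans js sT.
case: (@reach_nonzero (L - j) (used L (i :: p) (L - j))).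
  by apply: U5; lia.
by apply: (snd' j j5) => //; rewrite /mem_code /= nth0.
Qed.


Lemma run_sound L p vs nd : (4 <= L)%N -> uniq vs ->
  (forall q, q \in vs -> (l q = L %[mod d])%N /\ q \notin p) ->
  (forall q, q \in p -> (l q = L %[mod d])%N) ->
  sound_sets L p nd.1.1 ->
  exists nd', run T colour den (map cl vs) nd = Some nd' /\
    [/\ sound_sets L (rev vs ++ p) nd'.1.1, nd'.1.2 = (nd.1.2 + den * size vs)%N
      & nd'.2 = last nd.2 (map (colour \o cl) vs)].
Proof.
move=> L4; elim: vs p nd => [|i vs IH] p nd /=.
  by move=> _ _ _ snd; exists nd; split=> //; split=> //; rewrite muln0 addn0.
move=> /andP[ivs uvs] lv lp snd.
have [li ip] := lv i (mem_head _ _).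
have [nd1 [-> [snd1 su1 co1]]] := addvar_sound L4 li ip lp snd.
have [||nd2 [E [snd2 su2 co2]]] := IH (i :: p) nd1 uvs _ _ snd1.
- move=> q qvs; have [lq qp] := lv q (mem_behead (s := i :: vs) qvs).
  split=> //; rewrite inE negb_or qp andbT.
  by apply: contraNneq ivs => <-.
- by move=> q; rewrite inE => /orP[/eqP->|/lp].
exists nd2; rewrite /= E; split=> //; split.
- by rewrite rev_cons cat_rcons.
- by rewrite su2 su1 mulnS addnA.
- by rewrite co2 co1.
Qed.

Lemma advance_sound L p nd nd' : (4 <= L)%N ->
  (forall q, q \in p -> (l q = L %[mod d])%N) ->
  sound_sets L p nd.1.1 -> advance num off masks nd = Some nd' ->
  [/\ sound_sets L.+1 [::] nd'.1.1, nd'.1.2 = (nd.1.2 - num)%N & nd'.2 = nd.2].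
Proof.
move=> L4 lp snd; rewrite /advance; case: ifP => // _ [<-]; split=> // -[|j] j5 g vg.
  by rewrite (_ : mem_code _ g = false) // [LHS](nth_nseq false 32 false); case: ifP.
rewrite subSS => Ag.
have {}Ag : mem_code (nth [::] nd.1.1 j) g.
  have {}Ag : mem_code (nth [::] (prune masks nd.1.1) j) g := Ag.
  move: Ag; rewrite /mem_code /prune.
  case: (ltnP j (size (zip masks nd.1.1))) => [lt|ge]; last first.
    by rewrite [nth _ (map _ _) _]nth_default ?size_map // nth_nil.
  rewrite (nth_map ([::], [::])) // nth_zip_cond lt /=; move: (nth _ masks j) => M.
  move: (nth _ _ j) (code_index g) => A.
  by elim: M A => [|u M IH] [|v A] [|n] //=; [move=> /andP[] | apply: IH].
apply: reach_sub (snd j _ g vg Ag); last by lia.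
move=> i; rewrite /used orbF => /orP[|/lp li]; first by lia.
by rewrite (offset_level _ li); lia.
Qed.

Definition level_vars L : seq 'I_s :=
  flatten [seq [seq i <- [seq i <- enum 'I_s | l i == L %[mod d]] | cl i == k]
          | k <- iota 0 8].

Lemma level_vars_perm L :
  perm_eq (level_vars L) [seq i <- enum 'I_s | l i == L %[mod d]].
Proof.
apply: perm_trans (perm_by_class _ _ _) _; rewrite (all_filterP _) //.
by apply/allP => i _; apply: cl8.
Qed.

Lemma level_vars_uniq L : uniq (level_vars L).
Proof. by rewrite (perm_uniq (level_vars_perm L)) filter_uniq ?enum_uniq. Qed.

Lemma mem_level_vars L i : (i \in level_vars L) = (l i == L %[mod d]).
Proof. by rewrite (perm_mem (level_vars_perm L)) mem_filter mem_enum andbT. Qed.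

Variable r : nat.
(** Ensures that the starting levels L - j of the five windows are not truncated. *)
Hypothesis r4 : (4 <= r)%N.

Definition var_total t := (\sum_(0 <= j < t) size (level_vars (r + j)))%N.

Fixpoint last_colour t : bool :=
  if t is t'.+1 then last (last_colour t') (map (colour \o cl) (level_vars (r + t')))
  else false.

(** The surplus is bounded from below only, since a subsuming node may have a larger one. *)
Definition invariant t (nd : node) :=
  [/\ sound_sets (r + t) [::] nd.1.1, (den * var_total t <= nd.1.2 + num * t)%N
    & nd.2 = last_colour t].

Hypothesis enough : forall t, (num * t.+1 + off <= den * var_total t.+1)%N.

Lemma invariant_step t nd : invariant t nd ->
  (None \in successors T colour num den off nd) \/
  exists2 nd', Some nd' \in successors T colour num den off nd & invariant t.+1 nd'.
Proof.
move=> [snd sur col]; have L4 : (4 <= r + t)%N by lia.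
have [||nd1 [E [snd1 su1 co1]]] := run_sound L4 (level_vars_uniq (r + t)) _ _ snd.
- by move=> q; rewrite mem_level_vars => /eqP.
- by [].
rewrite cats0 in snd1.
have totS : var_total t.+1 = (var_total t + size (level_vars (r + t)))%N.
  by rewrite /var_total big_nat_recr.
have := enough t; rewrite totS mulnDr mulnS => en.
have su1E : (num + off <= nd1.1.2)%N.
  rewrite su1; move: en sur.
  by move: (den * var_total t)%N (num * t)%N (den * size _)%N (nd.1.2) => A B C D; lia.
have := E; rewrite /level_vars map_by_class => /explore_run/orP[] Ex; last first.
  left; rewrite /successors mem_pmap; apply/mapP.
  by exists None; first exact: Ex.
right; case Ea: (advance num off masks nd1) => [nd2|]; last first.
  by move: Ea; rewrite /advance su1E.
have [|snd2 su2 co2] := advance_sound L4 _ snd1 Ea.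
  by move=> q; rewrite mem_rev mem_level_vars => /eqP.
exists nd2.
  rewrite /successors mem_pmap; apply/mapP.
  by exists (Some nd1); [exact: Ex|rewrite Ea].
split; first by rewrite addnS.
  rewrite totS mulnDr mulnS su2; move: sur su1E; rewrite su1.
  by move: (den * var_total t)%N (num * t)%N (den * size _)%N (nd.1.2) => A B C D; lia.
by rewrite co2 co1 col.
Qed.

Lemma invariant_subsumes t x y : subsumes x y -> invariant t y -> invariant t x.
Proof.
move=> xy [snd sur col]; have /and3P[sxy /eqP cxy _] := xy; split.
- by move=> j j5 g vg /(subsumes_mem xy); apply: snd.
- by lia.
- by rewrite cxy.
Qed.

Lemma invariant_covers t X Y x : x \in X -> covers T colour num den off X Y ->
  invariant t x -> exists2 y, y \in Y & invariant t.+1 y.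
Proof.
move=> xX /allP/(_ _ xX)/allP cov /invariant_step[/cov//|[y /cov/hasP[z zY zy] iy]].
by exists z => //; apply: invariant_subsumes iy.
Qed.

Lemma invariant_layers final : closed_search T colour num den off final ->
  exists2 X, final X & forall n, exists2 x, x \in X & invariant (6 + 2 * n) x.
Proof.
rewrite /closed_search.
have sz n X : size (layers T colour num den off n X) = n.+1.
  by elim: n X => [|n IH] X //; rewrite -[RHS](congr1 S (IH (next_layer T colour num den off X))).
have := sz 7 init_layer.
have : nth [::] (layers T colour num den off 7 init_layer) 0 = init_layer by [].
move: (layers _ _ _ _ _ _ _) => L L0 sL /and3P[/(sortedP [::]) cov c76 fin].
have inv0 : invariant 0 (nseq 5 (nseq 32 false), 0%N, false).
  split; [|by rewrite /var_total big_geq // [(den * _)%N]muln0|by []].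
  move=> j j5 g vg Ag; exfalso; move: Ag.
  change (nth false (nth [::] (nseq 5 (nseq 32 false)) j) (code_index g) -> False).
  by rewrite [nth _ (nseq 5 _) j]nth_nseq j5 nth_nseq; case: ifP.
have inv t : (t < 8)%N -> exists2 x, x \in nth [::] L t & invariant t x.
  elim: t => [_|t IH t8]; first by rewrite L0; eexists; [exact: mem_head|exact: inv0].
  have [x xL ix] := IH (ltnW t8).
  by apply: invariant_covers xL _ ix; apply: cov; rewrite sL.
(* From time 6 on, two levels lead from layer 6 through layer 7 back to layer 6. *)
exists (nth [::] L 6) => //; elim=> [|n [x xX ix]]; first exact: inv.
have [y yY iy] := invariant_covers xX (cov 6 ltac:(by rewrite sL)) ix.
have := invariant_covers yY c76 iy.
by rewrite (_ : (6 + 2 * n.+1 = (6 + 2 * n).+2)%N); last by lia.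
Qed.

End SearchSound.

(* Start the period where the excess of the partial sums over their average
   is least. *)
Lemma cycle_lemma (n : nat -> nat) d s : (0 < d)%N ->
  (forall L, n (L + d) = n L)%N -> (\sum_(0 <= L < d) n L = s)%N ->
  exists2 r, (d <= r)%N & forall t, (s * t <= d * \sum_(0 <= j < t) n (r + j)%N)%N.
Proof.
move=> d0 per sumd; pose Q t := (\sum_(0 <= L < t) n L)%N.
have QS t : Q t.+1 = (Q t + n t)%N by rewrite /Q big_nat_recr.
have QD t u : Q (t + u)%N = (Q t + \sum_(0 <= j < u) n (t + j)%N)%N.
  elim: u => [|u IH]; first by rewrite big_geq // !addn0.
  by rewrite addnS QS IH big_nat_recr //= addnA.
have Qper k t : Q (k * d + t)%N = (k * s + Q t)%N.
  elim: k => // k IH; rewrite mulSn -addnA QD [Q d]sumd mulSn -addnA -IH.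
  by congr (_ + _)%N; apply: eq_bigr => j _; rewrite addnC per.
(* The quantity minimized is d * Q i - s * i, shifted by s * d to stay nonnegative. *)
case: (@arg_minnP _ (Ordinal d0) xpredT (fun i => d * Q i + s * (d - i))%N isT) => r _ rmin.
(* One period is added so that windows starting a few levels earlier still have nonnegative
   levels. *)
exists (d + r)%N; first exact: leq_addr.
move=> t; have -> : (\sum_(0 <= j < t) n (d + r + j) = \sum_(0 <= j < t) n (r + j))%N.
  by apply: eq_bigr => j _; rewrite -addnA addnC per.
have lt : ((r + t) %% d < d)%N by rewrite ltn_mod.
have := rmin (Ordinal lt) isT; rewrite /= => le.
have := QD r t; rewrite {1}(divn_eq (r + t) d) Qper => E.
have rtE := divn_eq (r + t) d; have rd := ltn_ord r.
move: E le rtE lt; move: ((r + t) %/ d)%N ((r + t) %% d)%N => q v E le rtE lt.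
have {}E : (d * (q * s) + d * Q v = d * Q r + d * \sum_(0 <= j < t) n (r + j))%N.
  by rewrite -!mulnDr E.
move: E le; move: (d * Q v)%N (d * Q r)%N (d * \sum_(_ <= _ < _) _)%N => A B C.
have : (s * (r + t) = d * (q * s) + s * v)%N by rewrite rtE; ring.
rewrite !mulnBr mulnDr; have : (s * v <= s * d)%N by rewrite leq_mul2l (ltnW lt) orbT.
have : (s * r <= s * d)%N by rewrite leq_mul2l (ltnW rd) orbT.
by lia.
Qed.

Section Levels.
Variables (d s : nat) (l cl : 'I_s -> nat).
Hypothesis d0 : (0 < d)%N.
Hypothesis cl8 : forall i, (cl i < 8)%N.

Lemma level_vars_periodic L : level_vars d l cl (L + d) = level_vars d l cl L.
Proof. by rewrite /level_vars modnDr. Qed.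

Lemma sum_level_vars : (\sum_(0 <= L < d) size (level_vars d l cl L) = s)%N.
Proof.
rewrite -[RHS]card_ord -sum1_card big_mkord.
rewrite (eq_bigr (fun L : 'I_d => (\sum_(i < s) (l i %% d == L))%N)); last first.
  move=> L _; rewrite (perm_size (level_vars_perm d l cl8 L)) size_filter.
  rewrite -sum1_count big_enum_cond /= big_mkcond; apply: eq_bigr => i _.
  by rewrite (modn_small (ltn_ord L)); case: ifP.
rewrite exchange_big /=; apply: eq_bigr => i _.
have lt : (l i %% d < d)%N by rewrite ltn_mod.
rewrite (bigD1 (Ordinal lt)) //= eqxx big1 // => L nL.
by case: eqP => // E; case/eqP: nL; apply: val_inj.
Qed.

Lemma level_start : exists2 r, (d <= r)%N &
  forall t, (s * t <= d * var_total d l cl r t)%N.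
Proof.
apply: (cycle_lemma (n := fun L => size (level_vars d l cl L)) d0 _ sum_level_vars).
by move=> L; rewrite level_vars_periodic.
Qed.

End Levels.

(** * Upper bounds *)

Lemma window_zero_odd a d (l cl : 'I_(d + 1) -> nat) : a \in [:: -1; -5] -> (6 <= d)%N ->
  (forall i, cl i < 8)%N -> window_zero a d l cl.
Proof.
move=> Ha d6 cl8; apply: NNPP => nz.
have Ra : a \in ramified by move: Ha; rewrite !inE => /orP[]->; rewrite ?orbT.
have ba : amod8 a \in [:: 3; 7]%N by move: Ha; rewrite !inE => /orP[] /eqP->.
have d0 : (0 < d)%N by lia.
have [r dr Hr] := level_start l d0 cl8.
have en t : (1 * t.+1 + 1 <= 1 * var_total d l cl r t.+1)%N.
  have := Hr t.+1; rewrite !mul1n mulnDl mul1n; move: (var_total _ _ _ _ _) => p Hp.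
  rewrite addn1 ltnNge; apply/negP => le.
  have : (d * p <= d * t.+1)%N by rewrite leq_mul2l le orbT.
  by move: Hp; move: (d * p)%N (d * t.+1)%N => A B; lia.
have r4 : (4 <= r)%N by lia.
have [X fX inv] := invariant_layers Ra d6 cl8 nz r4 en (search_odd ba).
(* At time t the surplus is at least t / d, which for t = 6 + 10 d exceeds the bound 9 of the
   search. *)
have [x xX [_ sur _]] := inv (5 * d)%N.
have {fX} := allP fX x xX; move: sur (Hr (6 + 2 * (5 * d))%N).
rewrite !mul1n; move: (var_total _ _ _ _ _) (x.1.2) => p q le Hp q9.
have : (d * p <= d * (9 + (6 + 2 * (5 * d))))%N by rewrite leq_mul2l; lia.
by nia.
Qed.

Lemma window_zero_even a m (l cl : 'I_(3 * m) -> nat) : a \in [:: 2; 10; -2; -10] ->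
  odd m -> (3 <= m)%N -> (forall i, cl i < 8)%N -> window_zero a (2 * m) l cl.
Proof.
move=> Ha om m3 cl8; apply: NNPP => nz; set d := (2 * m)%N in nz.
have d6 : (6 <= d)%N by rewrite /d; lia.
have Ra : a \in ramified by move: Ha; rewrite !inE => /or4P[]->; rewrite ?orbT.
have ba : amod8 a \in [:: 2; 6]%N by move: Ha; rewrite !inE => /or4P[] /eqP->.
have d0 : (0 < d)%N by lia.
have [r dr Hr] := level_start l d0 cl8.
have en t : (3 * t.+1 + 0 <= 2 * var_total d l cl r t.+1)%N.
  have := Hr t.+1; move: (var_total _ _ _ _ _) => p Hp.
  have m0 : (0 < m)%N by lia.
  rewrite addn0 -(leq_pmul2l m0) (_ : m * (3 * t.+1) = 3 * m * t.+1)%N; last by ring.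
  by rewrite (_ : m * (2 * p) = d * p)%N // /d; ring.
have r4 : (4 <= r)%N by lia.
have [X fX inv] := invariant_layers Ra d6 cl8 nz r4 en (search_even ba).
pose col t := last_colour d l cl odd r t.
have flip n : col (6 + 2 * n).+2 = ~~ col (6 + 2 * n)%N.
  have [x xX ix] := inv n.
  have /allP cx := allP fX x xX.
  have [/cx//|[y /cx/allP cy iy]] := invariant_step Ra d6 cl8 nz r4 en ix.
  have [/cy//|[z /cy cz [_ _ zc]]] := invariant_step Ra d6 cl8 nz r4 en iy.
  by case: ix => _ _ xc; move: cz; rewrite zc xc /col; do 2 case: last_colour.
have flips j n : col (6 + 2 * (n + j))%N = col (6 + 2 * n)%N (+) odd j.
  elim: j => [|j IH]; first by rewrite addn0 addbF.
  have -> : (6 + 2 * (n + j.+1) = (6 + 2 * (n + j)).+2)%N by lia.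
  by rewrite flip IH /= addbN.
(* A period consists of m steps of two levels, and m is odd, so the colour after a period would be
   the opposite one. *)
have := flips m 1%N; rewrite om addbT.
have -> : (6 + 2 * (1 + m) = (6 + 2 * 0 + d).+2)%N by rewrite /d; lia.
have := flip 0%N; have -> : (6 + 2 * 1 = (6 + 2 * 0).+2)%N by [].
move: (6 + 2 * 0)%N => t.
have stepS u : col u.+1 = last (col u) (map (odd \o cl) (level_vars d l cl (r + u))).
  by [].
have lp u : level_vars d l cl (r + (u + d)) = level_vars d l cl (r + u).
  by rewrite addnA level_vars_periodic.
rewrite !stepS -addSn !lp; move: (level_vars d l cl (r + t)) (level_vars d l cl (r + t.+1)).
(* If both levels are empty the colour cannot flip between t and t + 2; otherwise they determine the
   last colour, which is then the same one period later. *)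
move=> [|c cs] [|c' cs'] //=; first by case: (col t).
- by case: last.
- by case: last.
- by case: last.
Qed.

(** * Forms without zeros *)

Section PairCheck.
Variable b : nat.

Definition rnat (n : nat) : rq := (n %% 8, 0)%N.
Definition rlin (u v : nat) : rq := radd (rnat u) (rmul b (rnat v) (rsig b)).
Definition rparity (odd_q : bool) : rq := rpoly b [:: true; ~~ odd_q].

Definition rsigO (e0 : option bool) : rq := if e0 is Some e then rsigX b e else (0, 0)%N.

(** The sum over group q plus [varpi]^2 times the sum over group q + 1: A1 and B1 count the d-th
    powers with residue 1, A2 and B2 those with residue [sig], and [e0] is the residue for the
    additional variable of level 0. *)
Definition level_pair (odd_q : bool) (e0 : option bool) (A1 A2 B1 B2 : nat) : rq :=
  radd (radd (rsigO e0) (rmul b (rparity odd_q) (rlin A1 A2)))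
    (rmul b (rmul b (rvarpi b) (rvarpi b))
       (rmul b (rparity (~~ odd_q)) (rlin B1 B2))).

(** Exempt are the cases without a variable at the lower level and those with more than three
    variables in a group; otherwise the sum is not divisible by 4, which has valuation 4. *)
Definition pair_nonzero odd_q e0 : bool :=
  all (fun A1 => all (fun A2 => all (fun B1 => all (fun B2 =>
    let p := level_pair odd_q e0 A1 A2 B1 B2 in
    [|| (e0 == None) && (A1 + A2 == 0)%N, 3 < A1 + A2, 3 < B1 + B2
      | ~~ ((4 %| p.1) && (4 %| p.2))]%N)
  (iota 0 4)) (iota 0 4)) (iota 0 4)) (iota 0 4).

Definition pair_check : bool :=
  [&& pair_nonzero false None, pair_nonzero false (Some false),
      pair_nonzero false (Some true) & pair_nonzero true None].
End PairCheck.

Lemma even_pair_check b : b \in [:: 2; 6]%N -> pair_check b.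
Proof. by rewrite !inE => /orP[] /eqP->; vm_compute. Qed.

Section LowerBounds.
Variable a : int.
Hypothesis Ra : a \in ramified.
Let Ha := ramified_mod4 Ra.

(** A single truncation index n is taken beyond all thresholds and all precisions asked for, which
    turns a zero over the completion into an approximate zero in Z[sqrt a]. *)
Lemma zero_truncation d s (g : 'I_s -> quad a) (l : 'I_s -> nat) (x : 'I_s -> Kelt) :
  (0 < d)%N -> (exists i, Knonzero (x i)) ->
  additive_form_vanishes a d (fun i => of_seq (fun=> g i)) x ->
  exists (Y : 'I_s -> quad a) (u : 'I_s -> nat),
  [/\ forall i, Y i = 0 \/ exact (u i) (Y i), exists i, Y i != 0 &
      forall i, V (l i + u i * d + 5) (\sum_i g i * Y i ^+ d)].
Proof.
move=> d0 [j nzj] /(vanishesP Ha); set c := fun i : 'I_s => of_seq _; set E := (\max_i _)%N => H.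
have fe i : form_exp d c x i = (d * qexp (x i))%N by [].
have dE : (d %| E)%N.
  rewrite /E; elim/big_ind: _ => // [u v du dv|i _]; last by rewrite fe dvdn_mulr.
  by rewrite /maxn; case: ifP.
(* The coefficients have exponent 0, so E is d times the largest exponent L of the variables, and y
   is x cleared of denominators. *)
pose L := (E %/ d)%N; have EL : E = (d * L)%N by rewrite mulnC divnK.
pose y i n : quad a := 2 ^+ (L - qexp (x i)) * kseq a (x i) n.
have P i : exists q : nat * nat, (forall n, y i n = 0) \/
    (forall n, (q.2 <= n)%N -> exact q.1 (y i n)).
  have [/(Knonzero_exact Ha)[v [n0 Hv]]|nz] := classic (Knonzero (x i)).
    exists (2 * (L - qexp (x i)) + v, n0)%N; right=> n /Hv Ev; apply: exactM => //.
    by apply: exactX => //; apply: exact2.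
  by exists (0, 0)%N; left=> n; rewrite /y kseq0 // mulr0.
have [q Hq] := fin_all_exists P.
pose n := (\sum_i (q i).2 + \sum_i (l i + (q i).1 * d + 5))%N.
have len i (F : 'I_s -> nat) : (F i <= \sum_i F i)%N by rewrite (bigD1 i) //= leq_addr.
exists (fun i => y i n), (fun i => (q i).1); split.
- move=> i; have [->|Ei] := Hq i; [by left|right]; apply: Ei.
  by apply: leq_trans (leq_addr _ _); apply: (len i (fun i => (q i).2)).
- exists j; have [z|Ej] := Hq j; last first.
    apply/eqP => y0; have : exact (q j).1 (y j n).
      apply: Ej; apply: leq_trans (leq_addr _ _); exact: (len j (fun i => (q i).2)).
    by rewrite y0 /exact !Vzero.
  have [v [n0 Hv]] := Knonzero_exact Ha nzj.
  have : exact (2 * (L - qexp (x j)) + v) (y j n0).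
    by apply: exactM => //; [apply: exactX => //; apply: exact2|apply: Hv].
  by rewrite z /exact !Vzero.
move=> i; apply: (@V_le _ _ (2 * n)).
  apply: leq_trans (leq_pmull _ _) => //; apply: leq_trans (leq_addl _ _).
  exact: (len i (fun i => (l i + (q i).1 * d + 5)%N)).
suff VV : V (2 * n) (\sum_i 2 ^+ (E - form_exp d c x i) * kseq a (c i) n
    * kseq a (x i) n ^+ d - \sum_i g i * y i n ^+ d).
  by rewrite -(V_sub Ha VV); apply: (H n).
rewrite -sumrB; apply: V_sum => // k _.
have -> : g k * y k n ^+ d =
    2 ^+ (E - form_exp d c x k) * g k * kseq a (x k) n ^+ d.
  by rewrite /y exprMn -exprM fe EL -mulnBr [(d * _)%N]mulnC; ring.
rewrite -mulrBl; apply: VMr; rewrite -mulrBr; apply: VMl.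
exact: (of_seqP Ha (coherent_const (g k))).
Qed.

(** When s <= d the valuations of the nonzero terms are distinct modulo d, so the least of them is
    the valuation of the sum. *)
Lemma varpi_form_no_zero m s : odd m -> all_forms_have_zero a (2 * m) s -> (2 * m < s)%N.
Proof.
move=> om allz; rewrite ltnNge; apply/negP => sd; set d := (2 * m)%N in allz sd.
have d0 : (0 < d)%N by rewrite /d; case: (m) om.
have [x [nzx]] := allz (fun i => of_seq (fun=> varpi a ^+ i)).
move=> /(zero_truncation (fun i : 'I_s => i : nat) d0 nzx)[Y [u [EY [j nzj] VS]]].
pose w (i : 'I_s) := (i + u i * d)%N.
case: (@arg_minnP _ j (fun i => Y i != 0) w nzj) => i0 nz0 min0.
have EY0 i : Y i != 0 -> exact (u i) (Y i) by case: (EY i) => [->|//]; rewrite eqxx.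
have ET i : Y i != 0 -> exact (w i) (varpi a ^+ i * Y i ^+ d).
  by move=> nz; apply: exactM => //; [apply: exact_varpiX|apply/exactX/EY0].
have := VS i0; rewrite (bigD1 i0) //= addrC => VS0.
have /andP[_ /negP[]] := ET i0 nz0.
rewrite -(@V_addl _ Ha _ (\sum_(i | i != i0) varpi a ^+ i * Y i ^+ d)).
  by apply: V_le VS0; rewrite /w; lia.
apply: V_sum => // i ni.
have [->|nz] := eqVneq (Y i) 0; first by rewrite expr0n eqn0Ngt d0 mulr0 Vzero.
rewrite (exact_mono _ (ET i nz)) ltn_neqAle min0 // andbT.
apply: contraNneq ni => wE; apply/eqP/val_inj => /=.
have := congr1 (modn^~ d) wE; rewrite /w !(addnC (nat_of_ord _)) !modnMDl.
by rewrite !modn_small ?(leq_trans (ltn_ord _) sd).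
Qed.

(* Variable 0 is the additional one; both it and group 0 have level 0. *)
Definition group_of (i : nat) : nat := (i.-1 %/ 3)%N.
Definition group_unit (q : nat) : quad a := vpoly a [:: true; ~~ odd q].
Definition var_unit (i : nat) : quad a :=
  if i is 0 then 1 else group_unit (group_of i).

Lemma exact_group_unit q : exact 0 (group_unit q).
Proof.
rewrite (@exact_sub _ Ha _ _ 1) ?exact1 //.
rewrite /group_unit /= addrC addKr; apply: VMr.
by case/andP: (exact_varpi Ha).
Qed.

Lemma exact_var_unit i : exact 0 (var_unit i).
Proof. by case: i => [|i]; [apply: exact1|apply: exact_group_unit]. Qed.

Lemma red_nat n : red (n%:R : quad a) = rnat n.
Proof. by rewrite quad_natE; congr pair; rewrite /=; lia. Qed.

Lemma V4_red (x : quad a) : V 4 x = (4 %| (red x).1)%N && (4 %| (red x).2)%N.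
Proof.
rewrite (@V_evenE _ Ha 2) /=; case: x => u v /=.
by congr (_ && _); lia.
Qed.

Lemma level_pair_nonzero q (e0 : option bool) A1 A2 B1 B2 :
  amod8 a \in [:: 2; 6]%N -> (A1 + A2 <= 3)%N -> (B1 + B2 <= 3)%N ->
  (e0 != None -> ~~ odd q) -> (e0 != None) || (0 < A1 + A2)%N ->
  ~~ V 4 ((if e0 is Some e then sig a ^+ (e : bool) else 0)
          + group_unit q * (A1%:R + A2%:R * sig a)
          + varpi a ^+ 2 * (group_unit q.+1 * (B1%:R + B2%:R * sig a))).
Proof.
move=> /even_pair_check/and4P[c0 c1 c2 c3] A3 B3 q0 nz.
have rl u v : red (u%:R + v%:R * sig a : quad a) = rlin (amod8 a) u v.
  by rewrite redD redM !red_nat red_sig.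
have check : pair_nonzero (amod8 a) (odd q) e0.
  by case: e0 q0 nz => [[]|] /=; case: (odd q) => // /(_ isT).
rewrite V4_red !redD expr2 !redM !rl !red_vpoly red_varpi.
have -> : red (if e0 is Some e then sig a ^+ (e : bool) else 0 : quad a)
  = rsigO (amod8 a) e0.
  by case: (e0) => [e|]; [rewrite red_sigX|].
move: check => /allP/(_ A1); rewrite mem_iota => /(_ ltac:(by lia)).
move=> /allP/(_ A2); rewrite mem_iota => /(_ ltac:(by lia)).
move=> /allP/(_ B1); rewrite mem_iota => /(_ ltac:(by lia)).
move=> /allP/(_ B2); rewrite mem_iota => /(_ ltac:(by lia)).
rewrite /= !ltnNge A3 B3 /= => /orP[/andP[/eqP e0E /eqP AE]|//].
by move: nz; rewrite e0E AE.
Qed.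

Lemma card_split s (P e : pred 'I_s) :
  (#|[pred i | P i & ~~ e i]| + #|[pred i | P i & e i]| = #|P|)%N.
Proof. by rewrite addnC -(cardID e P); congr addn; apply: eq_card => i; rewrite !inE andbC. Qed.

Lemma sum_same_unit s (P e : pred 'I_s) c :
  (forall i, P i -> var_unit i = c) ->
  \sum_(i | P i) var_unit i * sig a ^+ e i =
  c * (#|[pred i | P i & ~~ e i]|%:R + #|[pred i | P i & e i]|%:R * sig a).
Proof.
move=> Pc; rewrite (eq_bigr (fun i => c * sig a ^+ e i)); last by move=> i /Pc->.
rewrite -mulr_sumr; congr (_ * _); rewrite (bigID e) /= addrC; congr (_ + _).
  rewrite (eq_bigr (fun=> 1)) ?sumr_const // => i /andP[_ /negbTE->].
  by rewrite expr0.
rewrite (eq_bigr (fun=> sig a)) ?sumr_const ?mulr_natl // => i /andP[_ ->].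
by rewrite expr1.
Qed.

Lemma card_group s (P : pred 'I_s) Q :
  (forall i : 'I_s, P i -> group_of i = Q /\ (i : nat) != 0%N) -> (#|P| <= 3)%N.
Proof.
move=> PQ; rewrite -[X in (_ <= X)%N]card_ord.
pose f (i : 'I_s) : 'I_3 := inord (i.-1 %% 3).
rewrite -(@card_in_image _ _ f) ?max_card // => i k Pi Pk /(congr1 val).
have [] := PQ i Pi; have [] := PQ k Pk; rewrite /f /= !inordK ?ltn_mod // /group_of.
by move=> qk k0 qi i0 E; apply: val_inj => /=; move: k0 i0 => /= k0 i0; lia.
Qed.

Lemma alternating_form_no_zero m s : odd m -> (3 <= m)%N -> amod8 a \in [:: 2; 6]%N ->
  all_forms_have_zero a (2 * m) s -> (3 * m <= s)%N.
Proof.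
move=> om m3 ba allz; rewrite leqNgt; apply/negP => s3; set d := (2 * m)%N in allz.
have d0 : (0 < d)%N by rewrite /d; case: (m) om.
pose q (i : 'I_s) := group_of i.
have [x [nzx]] := allz (fun i => of_seq (fun=> varpi a ^+ (2 * q i) * var_unit i)).
move=> /(zero_truncation (fun i => 2 * q i)%N d0 nzx)[Y [u [EY [j nzj] VS]]].
have EY0 i : Y i != 0 -> exact (u i) (Y i) by case: (EY i) => [->|//]; rewrite eqxx.
pose w (i : 'I_s) := (2 * q i + u i * d)%N.
have Pe i : exists e : bool, Y i != 0 -> V (w i + 5)
   (varpi a ^+ (2 * q i) * var_unit i * Y i ^+ d
     - varpi a ^+ w i * (var_unit i * sig a ^+ e)).
  have [->|nz] := eqVneq (Y i) 0; first by exists true.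
  have [e He] := exact_pow Ra om (EY0 i nz); exists e => _.
  rewrite /w exprD -!mulrA; rewrite -mulrBr -addnA; apply: VM.
    by case/andP: (exact_varpiX Ha (2 * q i)).
  by rewrite [_ * (var_unit i * _)]mulrCA -mulrBr; apply: VMl.
have [eps Heps] := fin_all_exists Pe.
case: (@arg_minnP _ j (fun i => Y i != 0) w nzj) => i0 nz0 min0.
(* All valuations w i are even, so modulo [varpi]^(W+4) only those equal to W or W + 2 count. *)
pose W := w i0; pose I0 i := (Y i != 0) && (w i == W).
pose I1 i := (Y i != 0) && (w i == W.+2).
pose A := \sum_(i | I0 i) var_unit i * sig a ^+ eps i.
pose B := \sum_(i | I1 i) var_unit i * sig a ^+ eps i.
have VAB : V 4 (A + varpi a ^+ 2 * B).
  apply: (V_cancel Ha (exact_varpiX Ha W)).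
  rewrite -(@V_sub _ Ha _ (\sum_i varpi a ^+ (2 * q i) * var_unit i * Y i ^+ d)).
    by apply: V_le (VS i0); rewrite /W /w; lia.
  rewrite mulrDr mulrA -exprD addn2 /A /B !mulr_sumr.
  rewrite (bigID I0) /= [X in _ + X - _](bigID I1) /= opprD addrACA.
  rewrite -sumrB; apply: VD => //.
    apply: V_sum => // i /andP[nzi /eqP wi]; rewrite -wi.
    by apply: V_le (Heps i nzi); rewrite wi; lia.
  rewrite addrAC; apply: VD => //; last first.
    apply: V_sum => // i /andP[n0 n1].
    have [->|nzi] := eqVneq (Y i) 0; first by rewrite expr0n eqn0Ngt d0 mulr0 Vzero.
    apply: (@V_le _ _ (w i)).
      move: n0 n1; rewrite /I0 /I1 nzi /= => n0 n1; have := min0 i nzi.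
      by rewrite /W /w /d in n0 n1 *; lia.
    rewrite -(addn0 (w i)) /w -addnA -mulrA; apply: VM.
      by case/andP: (exact_varpiX Ha (2 * q i)).
    by rewrite addn0; apply: VMl; apply: VX; case/andP: (EY0 i nzi).
  have I10 i : I1 i -> ~~ I0 i.
    by move=> /andP[nzi /eqP wi]; rewrite /I0 wi nzi /=; lia.
  rewrite (eq_bigl I1) => [|i]; last by case I: (I1 i); rewrite ?andbT ?andbF // I10.
  rewrite -sumrB; apply: V_sum => // i /andP[nzi /eqP wi]; rewrite -wi.
  by apply: V_le (Heps i nzi); rewrite wi; lia.
have qm i : (q i < m)%N by rewrite /q /group_of; have := ltn_ord i; lia.
have qW i k : (w i = W + 2 * k)%N -> q i = ((W./2 + k) %% m)%N.
  move=> wi; have -> : (W./2 + k = u i * m + q i)%N.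
    by move: wi; rewrite {1}/w /d -divn2; lia.
  by rewrite modnMDl modn_small.
set Q := (W./2 %% m)%N; have q0 i : I0 i -> q i = Q.
  by move=> /andP[_ /eqP wi]; rewrite (qW i 0%N) ?addn0 // muln0 addn0.
have I00 : I0 i0 by rewrite /I0 nz0 eqxx.
have Vp k (y : quad a) : (k <= 2)%N -> V k (varpi a ^+ 2 * y).
  by move=> k2; apply: VMr; apply: V_le k2 _; case/andP: (exact_varpiX Ha 2).
have [Qm|Qm] := eqVneq Q.+1 m.
  (* The group after m - 1 is group 0, of the same parity since m is odd; but group m - 1 has a
     single variable, so A is a unit. *)
  have I0E i : I0 i = (i == i0).
    apply/idP/eqP => [Ii|->//]; apply: val_inj => /=.
    have := q0 i Ii; have := q0 i0 I00; rewrite /q /group_of.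
    by have := ltn_ord i; have := ltn_ord i0; lia.
  have /andP[_ /negP[]] := exactM Ha (exact_var_unit i0) (exact_sig Ra (eps i0)).
  have AE : A = var_unit i0 * sig a ^+ eps i0 by rewrite /A (big_pred1 i0).
  rewrite -AE -(@V_addl _ Ha 1 (varpi a ^+ 2 * B)) ?Vp // addrC.
  exact: V_le VAB.
have q1 i : I1 i -> q i = Q.+1.
  move=> /andP[_ /eqP wi]; rewrite (qW i 1%N) ?muln1 ?addn2 //.
  rewrite -modnDml addn1 modn_small // ltn_neqAle Qm ltn_mod.
  by lia.
(* Variable 0 has its own unit and is split off; it can occur only when Q = 0. *)
pose J i := I0 i && ((i : nat) != 0%N).
pose e0 := omap eps [pick i | I0 i && ((i : nat) == 0%N)].
have AE : A = (if e0 is Some e then sig a ^+ (e : bool) else 0)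
    + group_unit Q * (#|[pred i | J i & ~~ eps i]|%:R + #|[pred i | J i & eps i]|%:R * sig a).
  rewrite /A (bigID (fun i : 'I_s => (i : nat) == 0%N)) /= -(@sum_same_unit _ J) => [|i];
    last first.
    by move=> /andP[/q0 <-]; rewrite /var_unit /q; case: (nat_of_ord i).
  congr (_ + _); rewrite /e0; case: pickP => [z /andP[Iz z0]|none] /=.
    rewrite (big_pred1 z) => [|i]; first by rewrite (eqP z0) mul1r.
    apply/idP/eqP => [/andP[_ iz]|->]; last by rewrite Iz z0.
    by apply: val_inj => /=; rewrite (eqP iz) (eqP z0).
  by rewrite big1 // => i; rewrite none.
have BE : B = group_unit Q.+1 *
   (#|[pred i | I1 i & ~~ eps i]|%:R + #|[pred i | I1 i & eps i]|%:R * sig a).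
  rewrite -sum_same_unit // => i Ii; have := q1 i Ii.
  by rewrite /var_unit /q; case: (nat_of_ord i) => // k ->.
move: VAB; rewrite AE BE; apply/negP; apply: level_pair_nonzero => //.
- rewrite card_split; apply: (@card_group _ _ Q) => i /andP[/q0 qi nz].
  by split.
- rewrite card_split; apply: (@card_group _ _ Q.+1) => i /q1 qi; split=> //.
  by apply/eqP => i0E; move: qi; rewrite /q i0E.
- rewrite /e0; case: pickP => //= z /andP[/q0 <- /eqP z0] _.
  by rewrite /q z0.
rewrite /e0; case: pickP => //= none; rewrite card_split; apply/card_gt0P.
by exists i0; have := none i0; rewrite /J /in_mem /= I00 /= => ->.
Qed.

End LowerBounds.

Theorem theorem1 (m : nat) (Hodd : odd m) (Hm : (3 <= m)%N) :
  let d := (2 * m)%N in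
  (forall a : int, a \in [:: 2; 10; -2; -10] ->
     Gamma_star_eq a d (3 * m)%N) /\
  (forall a : int, a \in [:: -1; -5] ->
     Gamma_star_eq a d (d + 1)%N).
Proof.
split=> a Ha.
  have Ra : a \in ramified by move: Ha; rewrite !inE => /or4P[]->; rewrite ?orbT.
  split; last by move=> s; apply: alternating_form_no_zero => //;
    move: Ha; rewrite !inE => /or4P[] /eqP->.
  by apply: all_forms_have_zero_of_window => // l cl cl8; apply: window_zero_even.
have Ra : a \in ramified by move: Ha; rewrite !inE => /orP[]->; rewrite ?orbT.
split; last by move=> s; rewrite addn1; apply: varpi_form_no_zero.
apply: all_forms_have_zero_of_window => // l cl cl8.
by apply: window_zero_odd => //; lia.
Qed.
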